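(* Let $\sigma>0$ with $\frac{1}{2\sigma}\notin\mathbb{N}$. Consider the two-velocity system for $2\pi$-periodic functions $f_\pm(x,t)$, $$\partial_tf_\pm\pm\sigma\partial_xf_\pm=\pm\tfrac12(f_--f_+),\qquad t\ge0,$$ with initial data $f^I=(f_+^I,f_-^I)^\top\in L^2(0,2\pi;\mathbb{R}^2)$, and let $f^\infty=(f_+^\infty,f_-^\infty)^\top$ be the constant state $f_+^\infty=f_-^\infty=\frac1{4\pi}\int_0^{2\pi}(f_+^I(x)+f_-^I(x))\,\mathrm{d}x$. Then the solution $f=(f_+,f_-)^\top$ satisfies $$\|f(t)-f^\infty\|_{L^2(0,2\pi;\mathbb{R}^2)}\le c\,e^{-\lambda t}\|f^I-f^\infty\|_{L^2(0,2\pi;\mathbb{R}^2)},\qquad t\ge0,$$ with $\lambda=\operatorname{Re}\big(\tfrac12-\sqrt{\tfrac14-\sigma^2}\big)$ and some constant $c>0$. *)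

(* Defs.v *)
From HB Require Import structures.
From mathcomp Require Import all_boot all_order all_algebra.
From mathcomp Require Import all_classical all_reals all_analysis.
Set Implicit Arguments. Unset Strict Implicit. Unset Printing Implicit Defensive.
Import Order.TTheory GRing.Theory Num.Theory.
Import numFieldNormedType.Exports.
Local Open Scope classical_set_scope.
Local Open Scope ring_scope.

Definition per_int (R : realType) : set R := `[0, 2 * pi]%classic.

Definition L2fun (R : realType) (g : R -> R) : Prop :=
  measurable_fun (@per_int R) g /\
  (@lebesgue_measure R).-integrable (@per_int R) (fun x => ((g x) ^+ 2)%:E).

Definition L2norm2 (R : realType) (gp gm : R -> R) : R :=
  Num.sqrt (fine (\int[@lebesgue_measure R]_(x in @per_int R)
                     ((gp x) ^+ 2 + (gm x) ^+ 2)%:E)%E).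

Definition Rint (R : realType) (g : R -> R) : R :=
  Rintegral (@lebesgue_measure R) (@per_int R) g.

Definition finf (R : realType) (fIp fIm : R -> R) : R :=
  (4 * pi)^-1 * Rint (fun x => fIp x + fIm x).

Definition test_fun (R : realType) (phi : R -> R) : Prop :=
  [/\ forall x, derivable phi x 1, continuous (derive1 phi) &
      forall x, phi (x + 2 * pi) = phi x].

(* (fp, fm) : [0,oo) -> L^2(0,2pi;R^2), t |-> (fp t, fm t), is a weak solution
   (in the sense of Ball) of
     d_t f_+ + sigma d_x f_+ =  1/2 (f_- - f_+),
     d_t f_- - sigma d_x f_- = -1/2 (f_- - f_+),
   with 2pi-periodic boundary conditions and initial datum (fIp, fIm):
   f is continuous into L^2, f(0) = f^I in L^2, and for every C^1 periodic
   test function phi, t |-> <f_pm(t), phi> is differentiable for t > 0 with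
   the derivative given by the equation after integration by parts. *)
Definition weak_solution (R : realType) (sigma : R) (fIp fIm : R -> R)
    (fp fm : R -> R -> R) : Prop :=
  [/\ forall t : R, 0 <= t -> L2fun (fp t) /\ L2fun (fm t),
      forall t0 : R, 0 <= t0 -> forall e : R, 0 < e -> exists2 d, 0 < d &
        forall t : R, 0 <= t -> `|t - t0| < d ->
          L2norm2 (fun x => fp t x - fp t0 x) (fun x => fm t x - fm t0 x) < e,
      L2norm2 (fun x => fp 0 x - fIp x) (fun x => fm 0 x - fIm x) = 0,
      forall phi : R -> R, test_fun phi -> forall t : R, 0 < t ->
        is_derive t 1 (fun s : R => Rint (fun x => fp s x * phi x))
          (sigma * Rint (fun x => fp t x * derive1 phi x)
           + 2^-1 * Rint (fun x => (fm t x - fp t x) * phi x)) &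
      forall phi : R -> R, test_fun phi -> forall t : R, 0 < t ->
        is_derive t 1 (fun s : R => Rint (fun x => fm s x * phi x))
          (- (sigma * Rint (fun x => fm t x * derive1 phi x))
           + 2^-1 * Rint (fun x => (fp t x - fm t x) * phi x))].

(* lambda = Re(1/2 - sqrt(1/4 - sigma^2)); Num.sqrt of a negative number is 0,
   which is exactly the real part of the (purely imaginary) complex root. *)
Definition decay_rate (R : realType) (sigma : R) : R :=
  2^-1 - Num.sqrt (4^-1 - sigma ^+ 2).

(* Main.v *)
Require Import Defs.
From HB Require Import structures.
From mathcomp Require Import all_boot all_order all_algebra.
From mathcomp Require Import all_classical all_reals all_analysis.
From mathcomp Require Import measurable_realfun.
From mathcomp Require Import ring lra.
Set Implicit Arguments. Unset Strict Implicit. Unset Printing Implicit Defensive.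
Import Order.TTheory GRing.Theory Num.Theory.
Import numFieldNormedType.Exports.
Local Open Scope ring_scope.

(** Testing the weak formulation with [cos (k x)] and [sin (k x)] turns the system into
    one linear ODE per frequency [k].  With [p = f_+ + f_-] and [q = f_+ - f_-], the
    functional [|p|^2 + |q|^2 - (2 a / k) (q_sin p_cos - q_cos p_sin)] decays like
    [exp (- 2 lambda t)] in every mode [k >= 1], where [a = 1 / (2 sigma)] if
    [2 sigma > 1] and [a = 2 sigma] if [2 sigma < 1].  Since [a < 1] does not depend on
    [k], the functional is equivalent to [|p|^2 + |q|^2] uniformly in [k].  In the mode
    [k = 0] the mass [p] vanishes after subtracting [f^infty], and [q] decays like
    [exp (- t)].  The modes are summed with Bessel's inequality at time [0] and Parseval's
    identity at time [t].

    Parseval's identity comes from the density of trigonometric polynomials in [L^2]: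
    for a suitable trigonometric polynomial [u] with values in [[0, 1]], the powers
    [(1 - u^(2n))^(n 4^n)] converge boundedly to the indicator of the arc [u < 1/2].
    Hence step functions, then bounded continuous, bounded measurable and finally square
    integrable functions can be approximated. *)

(** * Integration over a period *)

Section Integration.
Local Open Scope classical_set_scope.
Local Open Scope ring_scope.
Context (R : realType).
Implicit Types (f g h F : R -> R) (a b c M : R).

Local Notation mu := (@lebesgue_measure R).
Local Notation per := (@per_int R).
(* Unqualified, [Rint] is MathComp's integer qualifier. *)
Local Notation Rint := (@Defs.Rint R).

Definition per_integrable f : Prop := mu.-integrable per (EFin \o f).

Lemma twopi_gt0 : 0 < 2 * pi :> R.
Proof. by rewrite mulr_gt0// pi_gt0. Qed.

Lemma measurable_per : measurable (per : set (measurableTypeR R)).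
Proof. exact: measurable_itv. Qed.

Lemma mu_per : mu per = (2 * pi)%:E.
Proof.
by rewrite lebesgue_measure_itv/= lte_fin twopi_gt0 oppr0 adde0.
Qed.

Lemma mu_per_lty : (mu per < +oo)%E.
Proof. by rewrite mu_per ltry. Qed.

#[local] Hint Resolve measurable_per : core.

Lemma measurable_EFin_per f :
  measurable_fun (per : set (measurableTypeR R)) (EFin \o f) <-> measurable_fun per f.
Proof. exact: (@measurable_EFinP _ (measurableTypeR R)). Qed.

Lemma per_integrableD f g : per_integrable f -> per_integrable g ->
  per_integrable (fun x => f x + g x).
Proof. by move=> fi gi; exact: (integrableD measurable_per fi gi). Qed.

Lemma per_integrableZ c f : per_integrable f -> per_integrable (fun x => c * f x).
Proof. by move=> fi; exact: (integrableZl measurable_per c fi). Qed.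

Lemma per_integrableN f : per_integrable f -> per_integrable (fun x => - f x).
Proof.
by move=> /(per_integrableZ (-1)); under eq_fun do rewrite mulN1r.
Qed.

Lemma per_integrableB f g : per_integrable f -> per_integrable g ->
  per_integrable (fun x => f x - g x).
Proof. by move=> fi gi; apply: per_integrableD => //; exact: per_integrableN. Qed.

Lemma per_integrable_sum (I : Type) (s : seq I) (F : I -> R -> R) :
  (forall i, per_integrable (F i)) -> per_integrable (fun x => \sum_(i <- s) F i x).
Proof.
move=> Fi; elim: s => [|i s IH].
  under eq_fun do rewrite big_nil.
  exact: integrable0.
by under eq_fun do rewrite big_cons; exact: per_integrableD.
Qed.

Lemma per_integrable_le f g : measurable_fun per f ->
  (forall x, per x -> `|f x| <= g x) -> per_integrable g -> per_integrable f.
Proof.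
move=> mf fg gi; apply: le_integrable gi => //; first exact/measurable_EFin_per.
by move=> x /fg fgx; rewrite /= lee_fin (le_trans fgx)// ler_norm.
Qed.

Lemma per_integrable_cst c : per_integrable (fun _ => c).
Proof.
apply/integrableP; split; first exact: measurable_cst.
by rewrite integral_cst//= mu_per -EFinM ltry.
Qed.

Lemma per_integrable_bounded M f : measurable_fun per f ->
  (forall x, per x -> `|f x| <= M) -> per_integrable f.
Proof.
by move=> mf fM; apply: (@per_integrable_le _ (fun=> M)) => //; exact: per_integrable_cst.
Qed.

Lemma per_integrable_continuous f : continuous f -> per_integrable f.
Proof.
move=> cf; apply: continuous_compact_integrable; first exact: segment_compact.
exact: continuous_subspaceT.
Qed.

Lemma eq_Rint f g : (forall x, per x -> f x = g x) -> Rint f = Rint g.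
Proof. by move=> fg; apply: eq_Rintegral => x; rewrite inE => /fg. Qed.

Lemma RintD f g : per_integrable f -> per_integrable g ->
  Rint (fun x => f x + g x) = Rint f + Rint g.
Proof. by move=> fi gi; rewrite /Defs.Rint RintegralD. Qed.

Lemma RintB f g : per_integrable f -> per_integrable g ->
  Rint (fun x => f x - g x) = Rint f - Rint g.
Proof. by move=> fi gi; rewrite /Defs.Rint RintegralB. Qed.

Lemma RintZ c f : per_integrable f -> Rint (fun x => c * f x) = c * Rint f.
Proof. by move=> fi; rewrite /Defs.Rint RintegralZl. Qed.

Lemma Rint_sum (I : Type) (s : seq I) (F : I -> R -> R) :
  (forall i, per_integrable (F i)) ->
  Rint (fun x => \sum_(i <- s) F i x) = \sum_(i <- s) Rint (F i).
Proof.
move=> Fi; elim: s => [|i s IH].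
  rewrite big_nil; under eq_fun do rewrite big_nil.
  by rewrite /Defs.Rint Rintegral_cst// mul0r.
rewrite big_cons; under eq_fun do rewrite big_cons.
by rewrite RintD ?IH//; exact: per_integrable_sum.
Qed.

Lemma Rint_cst c : Rint (fun=> c) = c * (2 * pi).
Proof. by rewrite /Defs.Rint Rintegral_cst//= mu_per. Qed.

Lemma le_Rint f g : per_integrable f -> per_integrable g ->
  (forall x, per x -> f x <= g x) -> Rint f <= Rint g.
Proof. by move=> fi gi fg; apply: le_Rintegral. Qed.

Lemma Rint_ge0 f : (forall x, per x -> 0 <= f x) -> 0 <= Rint f.
Proof. by move=> f0; apply: Rintegral_ge0. Qed.

Lemma Rint_FTC f F : continuous f ->
  (forall x : R, is_derive x 1 F (f x)) -> Rint f = F (2 * pi) - F 0.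
Proof.
move=> cf dF; have cF : continuous F.
  by move=> x; apply: differentiable_continuous; apply/derivable1_diffP; apply: ex_derive.
rewrite /Defs.Rint /Rintegral (@continuous_FTC2 _ f F)//.
- exact: twopi_gt0.
- exact: continuous_subspaceT.
- split.
  + by move=> x _; apply: ex_derive.
  + exact/cvg_at_right_filter/cF.
  + exact/cvg_at_left_filter/cF.
- by move=> x _; rewrite derive1E; apply: derive_val.
Qed.

Lemma ae_per_open : {ae mu, forall x, per x -> 0 < x < 2 * pi}.
Proof.
apply: (@negligibleS _ _ _ mu ([set 0] `|` [set 2 * pi])).
  move=> x /= /not_implyP[]; rewrite /per_int/= in_itv/= => /andP[x0 x1] H.
  have [x00|x00] := eqVneq x 0; first by left.
  by right; apply/eqP; apply: contrapT => /negP x2; apply: H; rewrite !lt_neqAle x0 x1 x2 eq_sym x00.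
by apply: negligibleU; [exists [set 0]|exists [set 2 * pi]]; split => //; exact: lebesgue_measure_set1.
Qed.

(** The pointwise hypotheses concern the open interval only, its endpoints being a null set. This
    matters below: the approximants of a step function converge to the wrong value at [0], and those
    of a continuous function miss the point [2 * pi]. *)
Lemma Rint_dominated (f_ : nat -> R -> R) f g :
  (forall n, measurable_fun per (f_ n)) -> measurable_fun per f ->
  (forall x, 0 < x < 2 * pi -> f_ ^~ x @ \oo --> f x) -> per_integrable g ->
  (forall n x, 0 < x < 2 * pi -> `|f_ n x| <= g x) ->
  Rint (f_ n) @[n --> \oo] --> Rint f.
Proof.
move=> mf_ mf ff gi fg.
have [|||fi _ cvgi] := @dominated_convergence _ _ _ mu _ measurable_per
  (fun n => EFin \o f_ n) (EFin \o f) (EFin \o g)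
  (fun n => (measurable_EFin_per _).2 (mf_ n)) ((measurable_EFin_per _).2 mf).
- apply: (negligibleS _ ae_per_open) => x /= nP xo; apply: nP => px.
  by apply: cvg_EFin; [exact: nearW|exact: ff (xo px)].
- exact: gi.
- apply: (negligibleS _ ae_per_open) => x /= nP xo; apply: nP => n px.
  by rewrite /= lee_fin fg// xo.
apply: fine_cvg; rewrite fineK//.
exact: integrable_fin_num.
Qed.

End Integration.

(** * Square-integrable functions and the squared norm [sqint] *)

Section SquareIntegrable.
Context (R : realType).
Implicit Types (f g h : R -> R) (a b c M : R).

Local Notation mu := (@lebesgue_measure R).
Local Notation per := (@per_int R).
Local Notation Rint := (@Defs.Rint R).

Lemma L2fun_measurable f : L2fun f -> measurable_fun per f.
Proof. by case. Qed.

Lemma L2fun_sqr f : L2fun f -> per_integrable (fun x => f x ^+ 2).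
Proof. by case. Qed.

Lemma L2fun_bounded M f : measurable_fun per f ->
  (forall x, per x -> `|f x| <= M) -> L2fun f.
Proof.
move=> mf fM; split=> //; apply: (@per_integrable_bounded _ (M ^+ 2)).
  exact: measurable_funX.
by move=> x /fM fxM; rewrite normrX lerXn2r// nnegrE (le_trans _ fxM).
Qed.

Lemma continuous_measurable_per f : continuous f -> measurable_fun per f.
Proof.
by move=> cf; apply: measurable_funTS; exact: continuous_measurable_fun.
Qed.

Lemma L2fun_continuous f : continuous f -> L2fun f.
Proof.
move=> cf; split; first exact: continuous_measurable_per.
apply: per_integrable_continuous => x.
by under eq_fun do rewrite expr2; apply: cvgM; exact: cf.
Qed.

Lemma L2fun_cst c : L2fun (fun _ : R => c).
Proof. by apply: L2fun_continuous => x; exact: cvg_cst. Qed.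

Lemma L2funM f g : L2fun f -> L2fun g -> per_integrable (fun x => f x * g x).
Proof.
move=> [mf fi] [mg gi].
apply: (@per_integrable_le _ _ (fun x => f x ^+ 2 + g x ^+ 2)).
- exact: measurable_funM.
- move=> x _; rewrite ler_norml; apply/andP; split; nra.
- exact: per_integrableD.
Qed.

Lemma L2funZ c f : L2fun f -> L2fun (fun x => c * f x).
Proof.
move=> [mf fi]; split; first exact: measurable_funM.
have := per_integrableZ (c ^+ 2) fi.
by under eq_fun do rewrite -exprMn.
Qed.

Lemma L2funD f g : L2fun f -> L2fun g -> L2fun (fun x => f x + g x).
Proof.
move=> Lf Lg; have [mf fi] := Lf; have [mg gi] := Lg.
split; first exact: measurable_funD.
have := per_integrableD (per_integrableD fi gi) (per_integrableZ 2 (L2funM Lf Lg)).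
rewrite (_ : (fun x => _ + _) = (fun x => (f x + g x) ^+ 2))//.
by apply/funext => x; ring.
Qed.

Lemma L2funB f g : L2fun f -> L2fun g -> L2fun (fun x => f x - g x).
Proof.
move=> Lf Lg; have := L2funD Lf (L2funZ (-1) Lg).
by under eq_fun do rewrite mulN1r.
Qed.

Lemma L2fun_sum (I : Type) (s : seq I) (F : I -> R -> R) :
  (forall i, L2fun (F i)) -> L2fun (fun x => \sum_(i <- s) F i x).
Proof.
move=> Fi; elim: s => [|i s IH].
  by under eq_fun do rewrite big_nil; exact: L2fun_cst.
by under eq_fun do rewrite big_cons; exact: L2funD.
Qed.

Lemma L2fun_integrable f : L2fun f -> per_integrable f.
Proof.
by move=> Lf; have := L2funM Lf (L2fun_cst 1); under eq_fun do rewrite mulr1.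
Qed.

Definition sqint f : R := Rint (fun x => f x ^+ 2).

Lemma sqint_ge0 f : 0 <= sqint f.
Proof. by apply: Rint_ge0 => x _; exact: sqr_ge0. Qed.

Lemma L2norm2E f g : L2fun f -> L2fun g ->
  L2norm2 f g = Num.sqrt (sqint f + sqint g).
Proof. by move=> [_ fi] [_ gi]; rewrite /sqint -RintD. Qed.

(** This identity does the work of a triangle inequality, at the cost of a factor 2. It also passes
    between the pair [f_+], [f_-] and its sum and difference. *)
Lemma sqint_parallelogram f g : L2fun f -> L2fun g ->
  sqint (fun x => f x + g x) + sqint (fun x => f x - g x) = 2 * (sqint f + sqint g).
Proof.
move=> Lf Lg; have [_ fi] := Lf; have [_ gi] := Lg.
rewrite /sqint -!RintD//; last 2 first.
- exact: (L2fun_sqr (L2funD Lf Lg)).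
- exact: (L2fun_sqr (L2funB Lf Lg)).
rewrite -RintZ; last exact: per_integrableD.
by apply: eq_Rint => x _; ring.
Qed.

Lemma sqintB_triangle f g h : L2fun f -> L2fun g -> L2fun h ->
  sqint (fun x => f x - h x) <=
  2 * (sqint (fun x => f x - g x) + sqint (fun x => g x - h x)).
Proof.
move=> Lf Lg Lh; rewrite -sqint_parallelogram; [|exact: L2funB..].
rewrite (_ : (fun x => f x - g x + (g x - h x)) = (fun x => f x - h x)).
  by rewrite lerDl sqint_ge0.
by apply/funext => x; ring.
Qed.

End SquareIntegrable.

(** * The trigonometric system *)

Section TrigonometricSystem.
Context (R : realType).
Implicit Types (b c : bool) (j k n : nat) (x : R).

Local Notation per := (@per_int R).
Local Notation Rint := (@Defs.Rint R).

Definition trig b k x : R := if b then sin (k%:R * x) else cos (k%:R * x).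

Definition dtrig b k x : R := if b then k%:R * cos (k%:R * x) else - (k%:R * sin (k%:R * x)).

Lemma is_derive_trig b k x : is_derive x 1 (@trig b k) (dtrig b k x).
Proof.
have dlin : is_derive x 1 (fun y : R => k%:R * y) k%:R.
  have -> : (fun y : R => k%:R * y) = k%:R *: id by apply/funext.
  by apply: is_derive_eq; rewrite /GRing.scale/= mulr1.
case: b; rewrite /trig /dtrig.
- by have := is_derive1_comp (is_derive_sin (k%:R * x)) dlin; rewrite mulrC.
- have := is_derive1_comp (is_derive_cos (k%:R * x)) dlin.
  by rewrite mulNr mulrC.
Qed.

Lemma dtrigE b k x : dtrig b k x = (if b then k%:R else - k%:R) * trig (~~ b) k x.
Proof. by case: b; rewrite /dtrig /trig/= ?mulNr. Qed.

Lemma is_derive_dtrig b k x :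
  is_derive x 1 (@dtrig b k) (- (k%:R ^+ 2 * trig b k x)).
Proof.
have -> : dtrig b k = (if b then k%:R else - k%:R) *: trig (~~ b) k.
  by apply/funext => y; rewrite dtrigE.
have := @is_deriveZ _ _ _ (trig (~~ b) k) (if b then k%:R else - k%:R) x 1 _
  (is_derive_trig (~~ b) k x).
rewrite /GRing.scale/= dtrigE negbK.
suff -> : (if b then k%:R else - k%:R) *
  ((if ~~ b then k%:R else - k%:R) * trig b k x) = - (k%:R ^+ 2 * trig b k x) by [].
by case: b; rewrite /=; ring.
Qed.

Lemma is_derive_continuous (f df : R -> R) :
  (forall x, is_derive x 1 f (df x)) -> continuous f.
Proof.
move=> fdf x; apply: differentiable_continuous; apply/derivable1_diffP.
exact: ex_derive.
Qed.

Lemma continuous_trig b k : continuous (@trig b k).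
Proof. by apply: is_derive_continuous => x; exact: is_derive_trig. Qed.

Lemma continuous_dtrig b k : continuous (@dtrig b k).
Proof. by apply: is_derive_continuous => x; exact: is_derive_dtrig. Qed.

Lemma L2fun_trig b k : L2fun (@trig b k).
Proof. by apply: L2fun_continuous; exact: continuous_trig. Qed.

Lemma trigD2pi b k x : trig b k (x + 2 * pi) = trig b k x.
Proof.
rewrite /trig mulrDr; have -> : k%:R * (2 * pi) = (pi *+ 2) *+ k :> R.
  by rewrite -[RHS]mulr_natl -(mulr_natl pi 2).
by case: b; rewrite ?(periodicn (@sinD2pi R)) ?(periodicn (@cosD2pi R)).
Qed.

Lemma dtrigD2pi b k x : dtrig b k (x + 2 * pi) = dtrig b k x.
Proof. by rewrite !dtrigE trigD2pi. Qed.

Lemma derive1_trig b k : derive1 (@trig b k) = dtrig b k.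
Proof.
by apply/funext => x; rewrite derive1E; apply: derive_val; exact: is_derive_trig.
Qed.

Lemma test_fun_trig b k : test_fun (@trig b k).
Proof.
split.
- by move=> x; apply: ex_derive; exact: is_derive_trig.
- by rewrite derive1_trig; exact: continuous_dtrig.
- by move=> x; rewrite trigD2pi.
Qed.

(** The squared norm of [trig b k]. It is [0] for the zero function [sin (0 x)], so that dividing by
    it there gives [0]. *)
Definition trig_weight b k : R :=
  if k == 0%N then (if b then 0 else 2 * pi) else pi.

Lemma trig_weight_ge0 b k : 0 <= trig_weight b k.
Proof.
rewrite /trig_weight; case: ifP => _; last exact: pi_ge0.
by case: b => //; rewrite ltW// twopi_gt0.
Qed.

Lemma Rint_derivative_periodic (f F : R -> R) : continuous f ->
  (forall x, is_derive x 1 F (f x)) -> (forall x, F (x + 2 * pi) = F x) ->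
  Rint f = 0.
Proof. by move=> cf dF pF; rewrite (Rint_FTC cf dF) -[2 * pi]add0r pF subrr. Qed.

(* The antiderivative is the Wronskian of the two trigonometric functions. *)
Lemma trig_orthogonal b c j k : j != k ->
  Rint (fun x => trig b j x * trig c k x) = 0.
Proof.
move=> jk.
pose f x := trig b j x * trig c k x.
have cf : continuous f.
  by move=> x; apply: cvgM; exact: continuous_trig.
have fi : per_integrable f by exact: per_integrable_continuous.
pose W := trig b j * dtrig c k - dtrig b j * trig c k.
suff : Rint (fun x => (j%:R ^+ 2 - k%:R ^+ 2) * f x) = 0.
  rewrite RintZ// => /eqP; rewrite mulf_eq0 => /orP[|/eqP//].
  by rewrite subr_eq0 eqrXn2// ?eqr_nat ?(negbTE jk).
apply: (@Rint_derivative_periodic _ W).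
- by move=> x; apply: cvgMr; exact: cf.
- move=> x; rewrite /W.
  have d1 := is_derive_trig b j x; have d2 := is_derive_trig c k x.
  have d3 := is_derive_dtrig b j x; have d4 := is_derive_dtrig c k x.
  apply: is_derive_eq; rewrite /GRing.scale/= /f; ring.
- by move=> x; rewrite /W !fctE !trigD2pi !dtrigD2pi.
Qed.

Lemma Rint_sin_cos k : Rint (fun x => trig true k x * trig false k x) = 0.
Proof.
have [->|k0] := eqVneq k 0%N.
  rewrite (eq_Rint (g := fun=> 0)) ?Rint_cst ?mul0r// => x _.
  by rewrite /trig mul0r sin0 mul0r.
have kne0 : k%:R != 0 :> R by rewrite pnatr_eq0.
apply: (@Rint_derivative_periodic _ ((2 * k%:R)^-1 *: (trig true k * trig true k))).
- by move=> x; apply: cvgM; exact: continuous_trig.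
- move=> x; have d1 := is_derive_trig true k x.
  by apply: is_derive_eq; rewrite /GRing.scale/= /dtrig /trig /=; field.
- by move=> x; rewrite !fctE !trigD2pi.
Qed.

(** For [k > 0], [cos^2 - sin^2] has the periodic antiderivative [sin cos / k], hence integral [0],
    while [cos^2 + sin^2 = 1] has integral [2 pi]; so each square contributes [pi]. *)
Lemma Rint_trig_sqr b k : Rint (fun x => trig b k x * trig b k x) = trig_weight b k.
Proof.
rewrite /trig_weight; have [->|k0] := eqVneq k 0%N.
  case: b.
    rewrite (eq_Rint (g := fun=> 0)) ?Rint_cst ?mul0r// => x _.
    by rewrite /trig mul0r sin0 mul0r.
  rewrite (eq_Rint (g := fun=> 1)) ?Rint_cst ?mul1r// => x _.
  by rewrite /trig mul0r cos0 mul1r.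
have kne0 : k%:R != 0 :> R by rewrite pnatr_eq0.
have i b' : per_integrable (fun x => trig b' k x * trig b' k x).
  by apply: L2funM; exact: L2fun_trig.
have diff : Rint (fun x => trig false k x * trig false k x - trig true k x * trig true k x) = 0.
  apply: (@Rint_derivative_periodic _ (k%:R^-1 *: (trig true k * trig false k))).
  - by move=> x; apply: cvgB; apply: cvgM; exact: continuous_trig.
  - move=> x; have d1 := is_derive_trig true k x; have d2 := is_derive_trig false k x.
    by apply: is_derive_eq; rewrite /GRing.scale/= /dtrig /trig /=; field.
  - by move=> x; rewrite !fctE !trigD2pi.
have sum : Rint (fun x => trig false k x * trig false k x + trig true k x * trig true k x) = 2 * pi.
  rewrite (eq_Rint (g := fun=> 1)) ?Rint_cst ?mul1r// => x _.
  by rewrite /trig -!expr2 cos2Dsin2.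
move: diff sum; rewrite RintB// RintD//.
by case: b; lra.
Qed.

Lemma Rint_trigM b c j k : Rint (fun x => trig b j x * trig c k x) =
  if (b == c) && (j == k) then trig_weight b j else 0.
Proof.
have [->|jk] := eqVneq j k; last by rewrite andbF trig_orthogonal.
rewrite andbT; have [->|] := eqVneq b c; first exact: Rint_trig_sqr.
case: b; case: c => // _; rewrite -[RHS](Rint_sin_cos k)//.
by apply: eq_Rint => x _; rewrite mulrC.
Qed.

Lemma Rint_trig b k : k != 0%N -> Rint (trig b k) = 0.
Proof.
move=> k0; rewrite -(trig_orthogonal b false k0).
by apply: eq_Rint => x _; rewrite {3}/trig mul0r cos0 mulr1.
Qed.

End TrigonometricSystem.

(** * Bessel's inequality and best approximation for a finite orthogonal family *)

Section BestApproximation.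
Context (R : realType) (I : finType) (e : I -> R -> R) (w : I -> R).
Implicit Types (g : R -> R) (t : I -> R).

Local Notation Rint := (@Defs.Rint R).

Hypothesis Le : forall i, L2fun (e i).
Hypothesis orth : forall i j,
  Rint (fun x => e i x * e j x) = if i == j then w i else 0.

Let comb t x := \sum_i t i * e i x.

Let L2comb t : L2fun (comb t).
Proof. by apply: L2fun_sum => i; exact: L2funZ. Qed.

Let Rint_comb g t : L2fun g ->
  Rint (fun x => g x * comb t x) = \sum_i t i * Rint (fun x => g x * e i x).
Proof.
move=> Lg; transitivity (Rint (fun x => \sum_i t i * (g x * e i x))).
  by apply: eq_Rint => x _; rewrite /comb mulr_sumr; apply: eq_bigr => i _; ring.
rewrite Rint_sum.
  by apply: eq_bigr => i _; rewrite RintZ//; exact: L2funM.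
by move=> i; apply: per_integrableZ; exact: L2funM.
Qed.

(** The error is a separate quadratic polynomial in each [t i]. Inserting the minimizer, coefficient
    over weight, gives Bessel's inequality; completing the square gives the optimality of that
    choice. *)
Lemma sqintB_comb g t : L2fun g ->
  sqint (fun x => g x - \sum_i t i * e i x) =
  sqint g + \sum_i (w i * t i ^+ 2 - 2 * t i * Rint (fun x => g x * e i x)).
Proof.
move=> Lg; have Lt := L2comb t.
have gt := L2funM Lg Lt; have tt := L2funM Lt Lt.
have TT : Rint (fun x => comb t x * comb t x) = \sum_i w i * t i ^+ 2.
  rewrite Rint_comb//; apply: eq_bigr => i _.
  rewrite (eq_Rint (g := fun x => e i x * comb t x)); last by move=> x _; rewrite mulrC.
  rewrite Rint_comb// (bigD1 i)//= big1 ?addr0 ?orth ?eqxx; first by ring.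
  by move=> j ji; rewrite orth eq_sym (negbTE ji) mulr0.
rewrite /sqint; transitivity (Rint (fun x =>
    g x ^+ 2 + ((-2) * (g x * comb t x) + comb t x * comb t x))).
  by apply: eq_Rint => x _; rewrite -/(comb t x); ring.
rewrite RintD//; [|exact: L2fun_sqr|].
- rewrite RintD//; last exact: per_integrableZ.
  rewrite RintZ// TT Rint_comb// mulr_sumr -big_split/=.
  by congr (_ + _); apply: eq_bigr => i _; ring.
- by apply: per_integrableD => //; exact: per_integrableZ.
Qed.

Hypothesis w_ge0 : forall i, 0 <= w i.

Lemma bessel g : L2fun g ->
  \sum_i Rint (fun x => g x * e i x) ^+ 2 / w i <= sqint g.
Proof.
move=> Lg; have := sqint_ge0 (fun x => g x - comb (fun i => Rint (fun x => g x * e i x) / w i) x).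
rewrite sqintB_comb//.
set S := (X in _ + X); suff -> : S = - \sum_i Rint (fun x => g x * e i x) ^+ 2 / w i.
  by rewrite subr_ge0.
rewrite -sumrN; apply: eq_bigr => i _.
have [->|wi] := eqVneq (w i) 0; first by rewrite invr0 !mulr0 mul0r; ring.
by field.
Qed.

(** After completing the square in each [t i], the difference of the two sides is a sum of squares
    over weights. For weight [0] the linear term in [t i] would survive, so the coefficient has to
    vanish as well. *)
Lemma best_approximation g t : L2fun g ->
  (forall i, w i = 0 -> Rint (fun x => g x * e i x) = 0) ->
  sqint g <= sqint (fun x => g x - \sum_i t i * e i x) +
             \sum_i Rint (fun x => g x * e i x) ^+ 2 / w i.
Proof.
move=> Lg w0; rewrite sqintB_comb// -addrA lerDl -big_split/=.
apply: sumr_ge0 => i _; have [wi|wi] := eqVneq (w i) 0.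
  by rewrite wi invr0 w0// !mulr0 mul0r subrr addr0.
have -> : w i * t i ^+ 2 - 2 * t i * Rint (fun x => g x * e i x) +
    Rint (fun x => g x * e i x) ^+ 2 / w i =
    (w i * t i - Rint (fun x => g x * e i x)) ^+ 2 / w i by field.
by rewrite divr_ge0 ?sqr_ge0.
Qed.

End BestApproximation.

(** * Fourier coefficients and their weighted partial square sums *)

Section FourierCoefficients.
Context (R : realType).
Implicit Types (g : R -> R) (N k : nat) (b : bool).

Local Notation Rint := (@Defs.Rint R).

Definition fcoef b k g : R := Rint (fun x => g x * trig b k x).

Definition fsqsum N g : R := \sum_(k < N) \sum_(b : bool) fcoef b k g ^+ 2 / trig_weight R b k.

Definition trigpoly (T : R -> R) : Prop := exists N (t : nat -> bool -> R),
  T = fun x => \sum_(k < N) \sum_(b : bool) t k b * trig b k x.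

Let orth N (i j : 'I_N * bool) : Rint (fun x => trig i.2 i.1 x * trig j.2 j.1 x) =
  if i == j then trig_weight R i.2 i.1 else 0.
Proof. by rewrite Rint_trigM andbC. Qed.

Lemma fsqsum_le N g : L2fun g -> fsqsum N g <= sqint g.
Proof.
move=> Lg; rewrite /fsqsum pair_bigA.
apply: (bessel (e := fun i : 'I_N * bool => trig i.2 i.1)) => //.
- by move=> i; exact: L2fun_trig.
Qed.

Lemma trig_weight_eq0 b k : trig_weight R b k = 0 -> b /\ k = 0%N.
Proof.
rewrite /trig_weight; case: eqP => [k0|_ /eqP]; last by rewrite gt_eqF// pi_gt0.
by case: b => [//|/eqP]; rewrite gt_eqF// twopi_gt0.
Qed.

Lemma fcoef_sin0 g : fcoef true 0 g = 0.
Proof.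
rewrite /fcoef (eq_Rint (g := fun=> 0)) ?Rint_cst ?mul0r// => x _.
by rewrite /trig mul0r sin0 mulr0.
Qed.

(** The step from density to Parseval's identity: the part of the norm not captured by finitely many
    coefficients is at most the error of any trigonometric polynomial of that degree. *)
Lemma sqint_trigpoly_approx g T : L2fun g -> trigpoly T ->
  exists N, sqint g <= sqint (fun x => g x - T x) + fsqsum N g.
Proof.
move=> Lg [N [t ->]]; exists N; rewrite /fsqsum pair_bigA.
under eq_fun do rewrite pair_bigA.
apply: (best_approximation (e := fun i : 'I_N * bool => trig i.2 i.1)) => //.
- by move=> i; exact: L2fun_trig.
- by move=> i; exact: trig_weight_ge0.
- by move=> [k b] /= /trig_weight_eq0[-> ->]; exact: fcoef_sin0.
Qed.

(** Bessel's inequality for a single function, with [2 * pi] the largest weight. It makes each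
    coefficient continuous in the [L^2] norm. *)
Lemma fcoef_sqr_le b k g : L2fun g -> fcoef b k g ^+ 2 <= 2 * pi * sqint g.
Proof.
move=> Lg; have [w0|w0] := eqVneq (trig_weight R b k) 0.
  have [-> ->] := trig_weight_eq0 w0.
  by rewrite fcoef_sin0 expr0n mulr_ge0 ?sqint_ge0// ltW// twopi_gt0.
have wgt0 : 0 < trig_weight R b k by rewrite lt_neqAle eq_sym w0 trig_weight_ge0.
have : \sum_(i : unit) fcoef b k g ^+ 2 / trig_weight R b k <= sqint g.
  apply: (bessel (e := fun _ : unit => @trig R b k)) => // [_|[] []].
  - exact: L2fun_trig.
  - by rewrite Rint_trig_sqr.
rewrite big_const card_unit/= addr0 ler_pdivrMr// mulrC => /le_trans; apply.
rewrite ler_wpM2r ?sqint_ge0// /trig_weight; have := pi_ge0 R.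
by case: ifP => _; case: (b); lra.
Qed.

End FourierCoefficients.

(** * Density of trigonometric polynomials *)

Section TrigpolyAlgebra.
Context (R : realType).
Implicit Types (f g T u : R -> R) (N k : nat) (b : bool).

Lemma eq_trigpoly f g : f =1 g -> trigpoly f -> trigpoly g.
Proof. by move=> /funext ->. Qed.

Lemma trigpolyD f g : trigpoly f -> trigpoly g -> trigpoly (fun x => f x + g x).
Proof.
move=> [N [s ->]] [M [t ->]]; exists (maxn N M).
exists (fun k b => (if (k < N)%N then s k b else 0) + (if (k < M)%N then t k b else 0)).
apply/funext => x.
rewrite (big_ord_widen (maxn N M) (fun k => \sum_(b : bool) s k b * trig b k x)) ?leq_maxl//.
rewrite (big_ord_widen (maxn N M) (fun k => \sum_(b : bool) t k b * trig b k x)) ?leq_maxr//.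
rewrite [X in X + _]big_mkcond [X in _ + X]big_mkcond -big_split/=.
apply: eq_bigr => k _.
transitivity (\sum_(b : bool) ((if (k < N)%N then s k b else 0) * trig b k x +
    (if (k < M)%N then t k b else 0) * trig b k x)).
  by rewrite big_split/=; congr (_ + _); case: ifP => // _; rewrite big1// => b _; rewrite mul0r.
by apply: eq_bigr => b _; rewrite mulrDl.
Qed.

Lemma trigpoly0 : trigpoly (fun _ : R => 0 : R).
Proof. by exists 0%N, (fun _ _ => 0); apply/funext => x; rewrite big_ord0. Qed.

Lemma trigpolyZ (a : R) f : trigpoly f -> trigpoly (fun x => a * f x).
Proof.
move=> [N [t ->]]; exists N, (fun k b => a * t k b); apply/funext => x.
rewrite mulr_sumr; apply: eq_bigr => k _; rewrite mulr_sumr.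
by apply: eq_bigr => b _; rewrite mulrA.
Qed.

Lemma trigpoly_sum (I : Type) (s : seq I) (F : I -> R -> R) :
  (forall i, trigpoly (F i)) -> trigpoly (fun x => \sum_(i <- s) F i x).
Proof.
move=> HF; elim: s => [|i s IH].
  by under eq_fun do rewrite big_nil; exact: trigpoly0.
by under eq_fun do rewrite big_cons; exact: trigpolyD.
Qed.

Lemma trigpoly_trig b k : trigpoly (@trig R b k).
Proof.
exists k.+1, (fun j c => if (j == k) && (c == b) then 1 else 0).
apply/funext => x; rewrite big_ord_recr/= big1 ?add0r; last first.
  by move=> j _; rewrite big1// => c _; rewrite (ltn_eqF (ltn_ord j)) mul0r.
rewrite (bigD1 b)//= !eqxx mul1r big1 ?addr0// => c /negbTE ->.
by rewrite andbF mul0r.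
Qed.

Lemma trigpoly1 : trigpoly (fun _ : R => 1 : R).
Proof.
apply: eq_trigpoly (trigpoly_trig false 0) => x.
by rewrite /trig mul0r cos0.
Qed.

(** The product-to-sum formulas produce the frequencies one above and one below; frequency [0] is
    separate because it has no lower neighbour in [nat]. *)
Lemma trigM_trig1 b c k : trigpoly (fun x => @trig R b k x * trig c 1 x).
Proof.
case: k => [|k].
  case: b.
    by apply: eq_trigpoly trigpoly0 => x; rewrite {1}/trig mul0r sin0 mul0r.
  by apply: eq_trigpoly (trigpoly_trig c 1) => x; rewrite {2}/trig mul0r cos0 mul1r.
have kD (x : R) : k.+2%:R * x = k.+1%:R * x + x by rewrite -[k.+2]addn1 natrD mulrDl mul1r.
have kB (x : R) : k%:R * x = k.+1%:R * x - x by rewrite -[k.+1]addn1 natrD mulrDl mul1r addrK.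
have tD := fun d => trigpolyZ 2^-1 (trigpoly_trig d k.+2).
have tB (s : R) := fun d => trigpolyZ (s / 2) (trigpoly_trig d k).
case: b; case: c.
- apply: eq_trigpoly (trigpolyD (tB 1 false) (trigpolyZ (-1) (tD false))) => x.
  by rewrite /trig kD (kB x) !mul1r !cosD cosN sinN; field.
- apply: eq_trigpoly (trigpolyD (tD true) (tB 1 true)) => x.
  by rewrite /trig kD (kB x) !mul1r !sinD cosN sinN; field.
- apply: eq_trigpoly (trigpolyD (tD true) (tB (-1) true)) => x.
  by rewrite /trig kD (kB x) !mul1r !sinD cosN sinN; field.
- apply: eq_trigpoly (trigpolyD (tD false) (tB 1 false)) => x.
  by rewrite /trig kD (kB x) !mul1r !cosD cosN sinN; field.
Qed.

Lemma trigpolyM_trig1 c f : trigpoly f -> trigpoly (fun x => f x * trig c 1 x).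
Proof.
move=> [N [t ->]].
apply: (@eq_trigpoly (fun x => \sum_(k < N) \sum_(b : bool) t k b * (trig b k x * trig c 1 x))).
  move=> x; rewrite mulr_suml; apply: eq_bigr => k _; rewrite mulr_suml.
  by apply: eq_bigr => b _; rewrite mulrA.
by apply: trigpoly_sum => k; apply: trigpoly_sum => b; apply: trigpolyZ; exact: trigM_trig1.
Qed.

(** Trigonometric polynomials are stable under multiplication by [cos x] and [sin x], hence by [u];
    all the powers arise by iterating this multiplication. *)
Lemma trigpoly_power_peak (a0 a1 a2 : R) (n m : nat) :
  trigpoly (fun x => (1 - (a0 + a1 * cos x + a2 * sin x) ^+ n) ^+ m).
Proof.
pose u (x : R) := a0 + a1 * cos x + a2 * sin x.
have Mu f : trigpoly f -> trigpoly (fun x => f x * u x).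
  move=> Tf; have H := trigpolyD (trigpolyD (trigpolyZ a0 Tf)
    (trigpolyZ a1 (trigpolyM_trig1 false Tf))) (trigpolyZ a2 (trigpolyM_trig1 true Tf)).
  by apply: eq_trigpoly H => x; rewrite /trig /u !mul1r; ring.
have MuX f : trigpoly f -> trigpoly (fun x => f x * u x ^+ n).
  move=> Tf; elim: n => [|p IH].
    by apply: eq_trigpoly Tf => x; rewrite expr0 mulr1.
  by apply: eq_trigpoly (Mu _ IH) => x; rewrite exprSr mulrA.
elim: m => [|m IH]; first by apply: eq_trigpoly trigpoly1 => x; rewrite expr0.
apply: eq_trigpoly (trigpolyD IH (trigpolyZ (-1) (MuX _ IH))) => x.
by rewrite exprSr /u; ring.
Qed.

Lemma L2fun_trigpoly f : trigpoly f -> L2fun f.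
Proof.
move=> [N [t ->]]; apply: L2fun_sum => k; apply: L2fun_sum => b.
by apply: L2funZ; exact: L2fun_trig.
Qed.

End TrigpolyAlgebra.

(** * Powers that converge to the indicator of [u < 1/2] *)

Section PowerPeak.
Context (R : realType).
Local Open Scope classical_set_scope.
Local Open Scope ring_scope.
Implicit Types (u v x y : R) (n m : nat).

Lemma bernoulli_ge y n : -1 <= y -> 1 + n%:R * y <= (1 + y) ^+ n.
Proof.
move=> y1; elim: n => [|n IH]; first by rewrite mul0r addr0 expr0.
rewrite exprS; apply: (@le_trans _ _ ((1 + y) * (1 + n%:R * y))).
  have := ler0n R n; rewrite -[n.+1]addn1 natrD => n0; nra.
by rewrite ler_wpM2l//; lra.
Qed.

(** Since [(1 - y)^m (1 + y)^m = (1 - y^2)^m] is at most [1], Bernoulli's lower bound on [(1 + y)^m]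
    becomes an upper bound on [(1 - y)^m]. *)
Lemma expr_onem_le y m : 0 <= y <= 1 -> (1 - y) ^+ m <= (1 + m%:R * y)^-1.
Proof.
move=> /andP[y0 y1]; have my : 0 < 1 + m%:R * y by rewrite ltr_pwDl// mulr_ge0.
rewrite -[leRHS]mul1r ler_pdivlMr//.
apply: (@le_trans _ _ ((1 - y) ^+ m * (1 + y) ^+ m)).
  by rewrite ler_wpM2l ?exprn_ge0 ?subr_ge0//; apply: bernoulli_ge; lra.
rewrite -exprMn exprn_ile1//; nra.
Qed.

(** Each of the [n] copies of [v ^+ n] is at most a term of the geometric sum of the [v ^+ i] with
    [i < n], whose value is [(1 - v ^+ n) / (1 - v)]. *)
Lemma natmul_expr_le v n : 0 <= v < 1 -> n%:R * v ^+ n <= (1 - v)^-1.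
Proof.
move=> /andP[v0 v1]; rewrite -[leRHS]mul1r ler_pdivlMr ?subr_gt0//.
apply: (@le_trans _ _ (1 - v ^+ n)); last by rewrite gerBl exprn_ge0.
have -> : 1 - v ^+ n = (\sum_(i < n) v ^+ i) * (1 - v).
  by rewrite -[LHS]opprB subrX1 -mulNr opprB mulrC.
have -> : n%:R * v ^+ n = \sum_(i < n) v ^+ n by rewrite sumr_const card_ord mulr_natl.
apply: ler_wpM2r; first by rewrite subr_ge0 ltW.
by apply: ler_sum => i _; apply: ler_wiXn2l => //; [exact: ltW|exact: ltnW].
Qed.

(* The factor [n] in the exponent forces the limit [0] at the threshold [u = 1/2] itself. *)
Definition power_peak u n : R := (1 - u ^+ (2 * n)) ^+ (n * 4 ^ n).

Lemma power_peak_itv u n : 0 <= u <= 1 -> 0 <= power_peak u n <= 1.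
Proof.
move=> /andP[u0 u1]; have un : 0 <= u ^+ (2 * n) by exact: exprn_ge0.
have un1 : u ^+ (2 * n) <= 1 by exact: exprn_ile1.
rewrite /power_peak exprn_ge0 ?subr_ge0// exprn_ile1 ?subr_ge0//.
by rewrite gerBl.
Qed.

(** The product of the outer exponent with [u ^+ (2 * n)] is [n (2 u)^(2n)]. Below the threshold it
    tends to [0] and Bernoulli's inequality keeps the power near [1]; from the threshold on it is at
    least [n], and the power is at most [1 / (n + 1)]. *)
Lemma cvg_power_peak u : 0 <= u <= 1 ->
  power_peak u n @[n --> \oo] --> ((u < 2^-1)%R%:R : R).
Proof.
move=> u01; have /andP[u0 u1] := u01.
have quad n : u ^+ (2 * n) * 4 ^+ n = (2 * u) ^+ n * (2 * u) ^+ n.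
  rewrite -!exprMn exprM -exprMn; congr (_ ^+ n); ring.
have mE n : (n * 4 ^ n)%:R * u ^+ (2 * n) = n%:R * (2 * u) ^+ n * (2 * u) ^+ n.
  by rewrite natrM natrX -!mulrA -quad; ring.
have un n : 0 <= u ^+ (2 * n) by exact: exprn_ge0.
have un1 n : u ^+ (2 * n) <= 1 by exact: exprn_ile1.
have [u2|u2] := ltrP u 2^-1.
  (* One factor [(2 u)^n] absorbs the [n], at the price of the constant [(1 - 2 u)^-1]; the other
     one tends to [0]. *)
  apply: (@squeeze_cvgr _ _ _ _ (fun n => 1 - (1 - 2 * u)^-1 * (2 * u) ^+ n) (cst 1)).
  - apply: nearW => n; have /andP[_ ->] := power_peak_itv n u01; rewrite andbT.
    apply: (@le_trans _ _ (1 + (n * 4 ^ n)%:R * - u ^+ (2 * n))).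
      rewrite mulrN mE lerB// ler_wpM2r ?exprn_ge0 ?mulr_ge0//.
      by apply: natmul_expr_le; lra.
    by apply: bernoulli_ge; have := un1 n; lra.
  - rewrite -[X in _ --> X]subr0 -[X in _ --> _ - X](mulr0 (1 - 2 * u)^-1).
    apply: cvgB; first exact: cvg_cst.
    apply: cvgMr; apply: cvg_expr; rewrite ger0_norm; lra.
  - exact: cvg_cst.
apply: (@squeeze_cvgr _ _ _ _ (cst 0) harmonic).
- apply: nearW => n; have /andP[-> _] := power_peak_itv n u01 => /=.
  apply: (le_trans (expr_onem_le _ _)); first by rewrite un un1.
  rewrite mE lef_pV2 ?posrE ?ltr_pwDl// ?mulr_ge0 ?exprn_ge0 ?mulr_ge0//.
  rewrite -natr1 addrC lerD2l -mulrA ler_peMr// -expr2 -exprM exprn_ege1//; lra.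
- exact: cvg_cst.
- exact: cvg_harmonic.
Qed.

End PowerPeak.

(** * From step functions to all of [L^2] by successive approximation *)

Section Density.
Context (R : realType).
Local Open Scope classical_set_scope.
Local Open Scope ring_scope.
Implicit Types (f g h T : R -> R) (b c d M : R) (n : nat).

Local Notation mu := (@lebesgue_measure R).
Local Notation per := (@per_int R).
Local Notation Rint := (@Defs.Rint R).

Lemma sqint_cvg0 (h_ : nat -> R -> R) g (dom : R -> R) :
  (forall n, measurable_fun per (h_ n)) -> measurable_fun per g ->
  (forall x, 0 < x < 2 * pi -> h_ ^~ x @ \oo --> g x) -> per_integrable dom ->
  (forall n x, 0 < x < 2 * pi -> (g x - h_ n x) ^+ 2 <= dom x) ->
  sqint (fun x => g x - h_ n x) @[n --> \oo] --> (0 : R).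
Proof.
move=> mh mg hg domi ghdom.
rewrite (_ : (0 : R) = Rint (fun=> 0)); last by rewrite Rint_cst mul0r.
apply: (@Rint_dominated _ (fun n x => (g x - h_ n x) ^+ 2) _ dom) => //.
- by move=> n; apply: measurable_funX; exact: measurable_funB.
- move=> x x2; have H : (g x - h_ n x) @[n --> \oo] --> (0 : R).
    rewrite -[X in _ --> X](subrr (g x)); apply: cvgB; first exact: cvg_cst.
    exact: hg.
  rewrite -[X in _ --> X](mulr0 0).
  by under eq_fun do rewrite expr2; exact: cvgM.
- by move=> n x x2; rewrite ger0_norm ?sqr_ge0// ghdom.
Qed.

Definition trig_approximable g : Prop := L2fun g /\
  forall eps : R, 0 < eps -> exists2 T, trigpoly T & sqint (fun x => g x - T x) < eps.

Lemma trig_approximable_trigpoly T : trigpoly T -> trig_approximable T.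
Proof.
move=> tT; split; first exact: L2fun_trigpoly.
move=> eps eps0; exists T => //.
rewrite /sqint (eq_Rint (g := fun=> 0)) ?Rint_cst ?mul0r// => x _.
by rewrite subrr expr0n.
Qed.

Lemma trig_approximable_limit g : L2fun g ->
  (forall eps : R, 0 < eps ->
     exists2 h, trig_approximable h & sqint (fun x => g x - h x) < eps) ->
  trig_approximable g.
Proof.
move=> Lg H; split=> // eps eps0.
have e4 : 0 < eps / 4 by rewrite divr_gt0.
have [h [Lh Hh] gh] := H _ e4; have [T tT hT] := Hh _ e4.
exists T => //; apply: (le_lt_trans (sqintB_triangle Lg Lh (L2fun_trigpoly tT))).
lra.
Qed.

Lemma trig_approximable_dominated (h_ : nat -> R -> R) g (dom : R -> R) :
  (forall n, trig_approximable (h_ n)) -> L2fun g ->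
  (forall x, 0 < x < 2 * pi -> h_ ^~ x @ \oo --> g x) -> per_integrable dom ->
  (forall n x, 0 < x < 2 * pi -> (g x - h_ n x) ^+ 2 <= dom x) ->
  trig_approximable g.
Proof.
move=> Ah Lg hg domi ghdom; apply: trig_approximable_limit => // eps eps0.
have H : sqint (fun x => g x - h_ n x) @[n --> \oo] --> (0 : R).
  apply: sqint_cvg0 domi ghdom => //; last exact: L2fun_measurable.
  by move=> n; have [[]] := Ah n.
move/cvgrPdist_lt : H => /(_ _ eps0)[N _ /(_ N (leqnn N))].
rewrite sub0r normrN ger0_norm ?sqint_ge0// => hN.
by exists (h_ N).
Qed.

Lemma trig_approximableD f g : trig_approximable f -> trig_approximable g ->
  trig_approximable (fun x => f x + g x).
Proof.
move=> [Lf Af] [Lg Ag]; split; first exact: L2funD.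
move=> eps eps0; have e4 : 0 < eps / 4 by rewrite divr_gt0.
have [S tS fS] := Af _ e4; have [T tT gT] := Ag _ e4.
exists (fun x => S x + T x); first exact: trigpolyD.
have := sqint_parallelogram (L2funB Lf (L2fun_trigpoly tS)) (L2funB Lg (L2fun_trigpoly tT)).
have := sqint_ge0 (fun x => f x - S x - (g x - T x)).
rewrite (_ : (fun x => f x - S x + (g x - T x)) = (fun x => f x + g x - (S x + T x))).
  by move: fS gT; lra.
by apply/funext => x; ring.
Qed.

Lemma trig_approximableZ c f : trig_approximable f -> trig_approximable (fun x => c * f x).
Proof.
move=> [Lf Af]; split; first exact: L2funZ.
move=> eps eps0; have c1 : 0 < c ^+ 2 + 1 by rewrite ltr_wpDl// sqr_ge0.
have [T tT fT] := Af (eps / (c ^+ 2 + 1)) (divr_gt0 eps0 c1).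
exists (fun x => c * T x); first exact: trigpolyZ.
have -> : sqint (fun x => c * f x - c * T x) = c ^+ 2 * sqint (fun x => f x - T x).
  rewrite /sqint -RintZ; last exact: (L2fun_sqr (L2funB Lf (L2fun_trigpoly tT))).
  by apply: eq_Rint => x _; ring.
move: fT; rewrite ltr_pdivlMr// mulrC => fT; apply: le_lt_trans fT.
by rewrite ler_wpM2r ?sqint_ge0// lerDl.
Qed.

Lemma trig_approximable_sum (I : Type) (s : seq I) (F : I -> R -> R) :
  (forall i, trig_approximable (F i)) -> trig_approximable (fun x => \sum_(i <- s) F i x).
Proof.
move=> HF; elim: s => [|i s IH].
  under eq_fun do rewrite big_nil.
  by apply: trig_approximable_trigpoly; exact: trigpoly0.
by under eq_fun do rewrite big_cons; exact: trig_approximableD.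
Qed.

Lemma measurable_step b : measurable_fun per (fun x : R => (x < b)%R%:R : R).
Proof.
rewrite (_ : (fun x => _) = \1_(`]-oo, b[%classic : set R)).
  by apply: measurable_indic; exact: measurable_itv.
apply/funext => x; rewrite indicE; congr (_%:R).
by rewrite mem_setE in_itv.
Qed.

(* [u < 1/2] iff [cos (x - b/2) > cos (b/2)], an arc with endpoints [0] and [b]. *)
Lemma trig_approximable_step b : 0 <= b <= 2 * pi ->
  trig_approximable (fun x => (x < b)%R%:R).
Proof.
move=> /andP[b0 b2].
pose C := cos (b / 2); pose S := sin (b / 2).
(* Two cosines differ by at most [2], so the factor [1/4] keeps [u] in [[0, 1]]. *)
pose u x := (2^-1 + C / 4) + (- (C / 4)) * cos x + (- (S / 4)) * sin x.
have uE x : u x = 2^-1 - (cos (x - b / 2) - C) / 4.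
  by rewrite /u cosB -/C -/S; field.
have u01 x : 0 <= u x <= 1.
  rewrite uE; have := cos_le1 (x - b / 2); have := cos_geN1 (x - b / 2).
  have := cos_le1 (b / 2); have := cos_geN1 (b / 2); rewrite -/C.
  by move=> *; apply/andP; split; lra.
have pi0 := pi_gt0 R.
have uhalf x : 0 < x < 2 * pi -> (u x < 2^-1)%R = (x < b)%R.
  move=> /andP[x0 x2].
  have sx : 0 < sin (x / 2) by apply: sin_gt0_pi; apply/andP; split; lra.
  (* Here [cos (x - b/2) - cos (b/2) = 2 sin (x/2) sin ((b - x)/2)]. The first sine is positive on
     the open period and the second has the sign of [b - x]. *)
  have -> : u x = 2^-1 - sin (x / 2) * sin ((b - x) / 2) / 2.
    rewrite uE /C; have -> : x - b / 2 = x / 2 - (b - x) / 2 by field.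
    have -> : b / 2 = x / 2 + (b - x) / 2 by field.
    by rewrite cosB cosD; field.
  apply/idP/idP => [H|xb].
    rewrite ltNge; apply/negP => bx.
    have : 0 <= sin ((x - b) / 2) by apply: sin_ge0_pi; apply/andP; split; lra.
    rewrite -opprB mulNr sinN => sb.
    have : 0 < sin (x / 2) * sin ((b - x) / 2) by lra.
    by rewrite pmulr_rgt0//; lra.
  have sb : 0 < sin ((b - x) / 2) by apply: sin_gt0_pi; apply/andP; split; lra.
  by have := mulr_gt0 sx sb; lra.
apply: (@trig_approximable_dominated (fun n x => power_peak (u x) n) _ (fun=> 1)).
- by move=> n; apply: trig_approximable_trigpoly; exact: trigpoly_power_peak.
- apply: (@L2fun_bounded _ 1); first exact: measurable_step.
  by move=> x _; rewrite normr_nat; case: (_ < _).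
- by move=> x x2; rewrite -(uhalf _ x2); exact: cvg_power_peak.
- exact: per_integrable_cst.
- move=> n x _; have /andP[p0 p1] := power_peak_itv n (u01 x).
  by case: (_ < _); rewrite /=; nra.
Qed.

(** Sampling [h] at the left ends of [n + 1] equal cells gives a combination of step functions. It
    converges pointwise by continuity, with squared error at most [(2 M)^2]. *)
Lemma trig_approximable_bounded_continuous M h : continuous h ->
  (forall x, `|h x| <= M) -> trig_approximable h.
Proof.
move=> ch hM; have p0 := twopi_gt0 R.
pose d n : R := 2 * pi / n.+1%:R.
have d0 n : 0 < d n by rewrite divr_gt0.
pose h_ n x := \sum_(k < n.+1) h (k%:R * d n) * ((x < k.+1%:R * d n)%R%:R - (x < k%:R * d n)%R%:R).
have h_E n x : 0 < x < 2 * pi -> exists2 y, `|x - y| <= d n & h_ n x = h y.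
  move=> /andP[x0 x2]; pose k := Num.truncn (x / d n).
  have xd0 : 0 <= x / d n by rewrite divr_ge0// ltW.
  have /andP[kx xk] := truncn_itv xd0; rewrite -/k in kx xk.
  have kn : (k < n.+1)%N.
    rewrite /k truncn_lt_nat// ltr_pdivrMr// /d mulrCA divff ?mulr1 ?pnatr_eq0//.
  move: kx xk; rewrite ler_pdivlMr// ltr_pdivrMr// => kx xk.
  exists (k%:R * d n).
    move: xk; rewrite ger0_norm ?subr_ge0// -natr1 mulrDl mul1r => /ltW.
    by rewrite lerBlDl.
  (* Only the cell containing [x] contributes: in a cell to its left both steps are [0], in a cell
     to its right both are [1]. *)
  rewrite /h_ (bigD1 (Ordinal kn))//= xk ltNge kx/= subr0 mulr1 big1 ?addr0// => i ik.
  have [ik'|ki|ik'] := ltngtP i k.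
  - have ikx : i.+1%:R * d n <= x.
      by apply: le_trans kx; rewrite ler_pM2r// ler_nat.
    have ix : i%:R * d n <= x.
      by apply: le_trans ikx; rewrite ler_pM2r// ler_nat.
    by rewrite !ltNge ikx ix subrr mulr0.
  - have xi : x < i%:R * d n.
      by apply: lt_le_trans xk _; rewrite ler_pM2r// ler_nat.
    have xi' : x < i.+1%:R * d n.
      by apply: lt_le_trans xi _; rewrite ler_pM2r// ler_nat.
    by rewrite xi xi' subrr mulr0.
  - by move: ik; rewrite -val_eqE/= ik' eqxx.
have step k n : (k <= n.+1)%N -> trig_approximable (fun x => (x < k%:R * d n)%R%:R).
  move=> kn; apply: trig_approximable_step.
  rewrite mulr_ge0 ?(ltW (d0 n))//= /d mulrCA ger_pMr//.
  by rewrite ler_pdivrMr// mul1r ler_nat.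
apply: (@trig_approximable_dominated h_ _ (fun=> (M + M) ^+ 2)).
- move=> n; apply: trig_approximable_sum => k; apply: trig_approximableZ.
  have := trig_approximableD (step k.+1 n (ltn_ord k))
    (trig_approximableZ (-1) (step k n (ltnW (ltn_ord k)))).
  by under eq_fun do rewrite mulN1r.
- exact: L2fun_continuous.
- move=> x x2; apply/cvgrPdist_lt => eps eps0.
  have /cvgrPdist_lt/(_ _ eps0)/nbhs_ballP[del /= del0 hdel] := ch x.
  have d_cvg : d n @[n --> \oo] --> (0 : R).
    by rewrite -[X in _ --> X](mulr0 (2 * pi)); apply: cvgMr; exact: cvg_harmonic.
  have /cvgrPdist_lt/(_ _ del0) := d_cvg; apply: filterS => n.
  rewrite sub0r normrN gtr0_norm// => dn.
  have [y xy ->] := h_E n x x2.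
  by apply: hdel; rewrite /ball/=; exact: le_lt_trans dn.
- exact: per_integrable_cst.
- move=> n x x2; have [y _ ->] := h_E n x x2.
  rewrite -real_normK ?num_real// lerXn2r ?nnegrE//.
    by rewrite addr_ge0// (le_trans _ (hM x)).
  by rewrite (le_trans (ler_normB _ _))// lerD.
Qed.

Definition clamp M x : R := Num.max (- M) (Num.min M x).

Lemma normr_clamp M x : 0 <= M -> `|clamp M x| <= M.
Proof.
by move=> M0; rewrite ler_norml /clamp le_max lexx/= ge_max ge_min lexx/= andbT; lra.
Qed.

Lemma clamp_id M x : `|x| <= M -> clamp M x = x.
Proof. by rewrite ler_norml => /andP[a b]; rewrite /clamp min_r// max_r. Qed.

(** [clamp M] projects onto [[-M, M]], which never increases the distance to a point of that
    interval. *)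
Lemma clamp_dist M x y : `|x| <= M -> `|x - clamp M y| <= `|x - y|.
Proof.
rewrite ler_norml => /andP[Mx xM]; rewrite /clamp.
have [yM|My] := leP M y.
  by rewrite (@max_r _ _ (- M) M) ?(le_trans Mx)// !ler0_norm; lra.
have [yM|My'] := leP (- M) y; first by [].
by rewrite !ger0_norm; lra.
Qed.

Lemma dist_clamp_le M y : 0 <= M -> `|y - clamp M y| <= `|y|.
Proof.
move=> M0; have := ler_norm y; have := ler_norm (- y); rewrite normrN => y1 y2.
rewrite ler_norml /clamp; have [yM|My] := leP M y.
  by rewrite (@max_r _ _ (- M) M); [apply/andP; split; lra|lra].
by have [yM|My'] := leP (- M) y; apply/andP; split; lra.
Qed.

Lemma continuous_clamp M h : continuous h -> continuous (fun x => clamp M (h x)).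
Proof.
move=> ch x; apply: (@continuous_max _ _ (fun=> - M) (fun x => Num.min M (h x))).
  exact: cvg_cst.
by apply: (@continuous_min _ _ (fun=> M) h); [exact: cvg_cst|exact: ch].
Qed.

Lemma measurable_clamp M h : measurable_fun per h ->
  measurable_fun per (fun x => clamp M (h x)).
Proof.
move=> mh; apply: (@measurable_maxr _ _ _ _ (fun=> - M) (fun x => Num.min M (h x))) => //.
exact: (@measurable_minr _ _ _ _ (fun=> M) h).
Qed.

(** Continuous functions are dense in [L^1]. Clamping them to [[-M, M]] does not increase the error
    and bounds it by [2 M], so the squared [L^2] error is at most [2 M] times the [L^1] error. *)
Lemma trig_approximable_bounded M g : measurable_fun per g ->
  (forall x, per x -> `|g x| <= M) -> trig_approximable g.
Proof.
move=> mg gM.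
have M0 : 0 <= M.
  apply: le_trans (gM 0 _) => //.
  by rewrite /per_int/= in_itv/= lexx ltW// twopi_gt0.
have Lg := L2fun_bounded mg gM.
have gi := L2fun_integrable Lg.
have [c_ [cc ic cg]] := approximation_continuous_integrable (@measurable_per R)
  (@mu_per_lty R) gi.
apply: trig_approximable_limit => // eps eps0.
(* The summand [1] keeps the denominator positive when [M = 0]. *)
have e2 : (0 < eps / (2 * M + 1))%R by rewrite divr_gt0//; lra.
have /cvgrPdist_lt/(_ _ e2)[n _ /(_ n (leqnn n))] : fine
    (\int[mu]_(z in per) `|(g z - c_ n z)%:E|)%E @[n --> \oo] --> (0 : R).
  exact: fine_cvg cg.
rewrite sub0r normrN => gcn.
exists (fun x => clamp M (c_ n x)).
  apply: (@trig_approximable_bounded_continuous M); first exact: continuous_clamp.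
  by move=> x; exact: normr_clamp.
have gci : per_integrable (fun x => g x - c_ n x) by exact: (per_integrableB gi (ic n)).
have Rlt : Rint (fun x => `|g x - c_ n x|) < eps / (2 * M + 1).
  by apply: le_lt_trans gcn; exact: ler_norm.
apply: (@le_lt_trans _ _ (Rint (fun x => (2 * M) * `|g x - c_ n x|))).
  apply: le_Rint.
  - apply: L2fun_sqr; apply: L2funB => //; apply: L2fun_continuous.
    exact: continuous_clamp.
  - by apply: per_integrableZ; exact: (integrable_norm gci).
  - move=> x px; rewrite -real_normK ?num_real// expr2 ler_pM//.
      rewrite (le_trans (ler_normB _ _))// mulr_natl mulr2n lerD//; first exact: gM.
      exact: normr_clamp.
    by apply: clamp_dist; exact: gM.
rewrite RintZ; last exact: (integrable_norm gci).
move: Rlt; rewrite ltr_pdivlMr; last by lra.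
apply: le_lt_trans; rewrite mulrC ler_wpM2l//; last by lra.
by apply: Rint_ge0 => x _.
Qed.

(** The truncations of [g] at height [n] are bounded, agree with [g] at each point from some [n] on,
    and have squared error at most [g ^+ 2]. *)
Lemma trig_approximable_L2fun g : L2fun g -> trig_approximable g.
Proof.
move=> Lg; have mg := L2fun_measurable Lg.
apply: (@trig_approximable_dominated (fun n x => clamp n%:R (g x)) _ (fun x => g x ^+ 2)).
- move=> n; apply: (@trig_approximable_bounded n%:R); first exact: measurable_clamp.
  by move=> x _; exact: normr_clamp.
- by [].
- move=> x _; apply: cvg_near_cst.
  exists (Num.truncn `|g x|).+1 => // n /= gn; apply: clamp_id.
  by rewrite ltW// (lt_le_trans (truncnS_gt _))// ler_nat.
- exact: L2fun_sqr.
- move=> n x _; rewrite -real_normK ?num_real// -[leRHS]real_normK ?num_real//.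
  by rewrite lerXn2r ?nnegrE// dist_clamp_le.
Qed.

End Density.

(** * Decay of a single Fourier mode *)

Section ExponentialDecay.
Context (R : realType).
Local Open Scope classical_set_scope.
Local Open Scope ring_scope.

(** Gronwall's argument: [expR (c * t) * E t] is nonincreasing. The equation holds only for [t > 0],
    so the value at [0] is reached through continuity from the right. *)
Lemma derive_le_exp_decay (E dE : R -> R) (c : R) :
  (forall t : R, 0 < t -> is_derive t 1 E (dE t)) ->
  (forall t : R, 0 < t -> dE t + c * E t <= 0) ->
  E t @[t --> 0^'+] --> E 0 ->
  forall t : R, 0 <= t -> E t <= expR (- (c * t)) * E 0.
Proof.
move=> dEt Ele E0 t; rewrite le_eqVlt => /orP[/eqP <-|t0].
  by rewrite mulr0 oppr0 expR0 mul1r.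
pose F (s : R) := expR (c * s) * E s.
have dexp (s : R) : is_derive s 1 (fun y : R => expR (c * y)) (c * expR (c * s)).
  have dlin : is_derive s 1 (fun y : R => c * y) c.
    have -> : (fun y : R => c * y) = c *: id by apply/funext.
    by apply: is_derive_eq; rewrite /GRing.scale/= mulr1.
  by have := is_derive1_comp (is_derive_expR (c * s)) dlin; rewrite mulrC.
have dF (s : R) : 0 < s -> is_derive s 1 F (expR (c * s) * (dE s + c * E s)).
  move=> s0; have d1 := dexp s; have d2 := dEt s s0.
  have -> : F = (fun y : R => expR (c * y)) * E by [].
  by apply: is_derive_eq; rewrite /GRing.scale/=; ring.
have : F t <= F 0.
  apply: (@ler0_derive1_le_cc _ F 0 t); rewrite ?in_itv/= ?lexx ?(ltW t0)//.
  - by move=> s; rewrite in_itv/= => /andP[s0 _]; apply: ex_derive; exact: dF.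
  - move=> s; rewrite in_itv/= => /andP[s0 _].
    rewrite derive1E; have -> := @derive_val _ _ _ _ _ _ _ (dF s s0).
    by rewrite mulr_ge0_le0 ?expR_ge0// Ele.
  - apply: derivable_oo_LRcontinuous_within; split.
    + by move=> s; rewrite in_itv/= => /andP[s0 _]; apply: ex_derive; exact: dF.
    + apply: cvgM => //; apply: cvg_at_right_filter.
      exact: (is_derive_continuous dexp).
    + apply: cvg_at_left_filter.
      have /derivable1_diffP/differentiable_continuous : derivable F t 1.
        by apply: ex_derive; exact: dF.
      exact.
rewrite /F mulr0 expR0 mul1r => H.
by rewrite expRN mulrC ler_pdivlMr ?expR_gt0// mulrC.
Qed.

End ExponentialDecay.

(** * The Lyapunov functional of one frequency *)

Section FourierMode.
Context (R : realType).
Local Open Scope classical_set_scope.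
Local Open Scope ring_scope.
Implicit Types (sigma : R) (k : nat) (b : bool) (u v : bool -> R -> R).

(* [trig true k] and [trig false k] are [sin (k x)] and [cos (k x)]: the system for the
   Fourier coefficients [u b] of [f_+] and [v b] of [f_-] at frequency [k]. *)
Definition mode_system sigma k u v : Prop :=
  [/\ forall b (t : R), 0 < t -> is_derive t 1 (u b)
        (sigma * ((if b then k%:R else - k%:R) * u (~~ b) t) + 2^-1 * (v b t - u b t)),
      forall b (t : R), 0 < t -> is_derive t 1 (v b)
        (- (sigma * ((if b then k%:R else - k%:R) * v (~~ b) t)) + 2^-1 * (u b t - v b t)),
      forall b, u b t @[t --> 0^'+] --> u b 0 &
      forall b, v b t @[t --> 0^'+] --> v b 0].

Definition mode_energy u v (t : R) : R :=
  \sum_(b : bool) ((u b t + v b t) ^+ 2 + (u b t - v b t) ^+ 2).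

Definition coupling sigma : R := if 1 < 2 * sigma then (2 * sigma)^-1 else 2 * sigma.

(** The strict bound by [1] makes the functional coercive. At [2 * sigma = 1] the coupling is [1],
    and for [k = 1] the functional degenerates to two squares in four unknowns. *)
Lemma coupling_lt1 sigma : 0 < sigma -> 2 * sigma != 1 -> 0 < coupling sigma < 1.
Proof.
move=> s0 s1; rewrite /coupling; case: (ltrP 1 (2 * sigma)) => s2.
  by rewrite invr_gt0 mulr_gt0//= invf_lt1// mulr_gt0.
by rewrite mulr_gt0//= lt_neqAle s1.
Qed.

Lemma decay_rate_fast sigma : 1 < 2 * sigma -> decay_rate sigma = 2^-1.
Proof.
by move=> s; rewrite /decay_rate ler0_sqrtr ?subr0//; nra.
Qed.

(** The rate is the smaller root of [x^2 - x + sigma^2], whose roots are the decay rates of the mode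
    [k = 1]. *)
Lemma decay_rate_slow sigma : 0 < sigma -> 2 * sigma < 1 ->
  [/\ 0 < decay_rate sigma, decay_rate sigma < 2^-1 &
      decay_rate sigma * (1 - decay_rate sigma) = sigma ^+ 2].
Proof.
move=> s0 s; rewrite /decay_rate; set r := Num.sqrt _.
have pos : 0 < 4^-1 - sigma ^+ 2 by nra.
have rr : r ^+ 2 = 4^-1 - sigma ^+ 2 by rewrite sqr_sqrtr// ltW.
have r0 : 0 < r by rewrite sqrtr_gt0.
split.
- have s2 : 0 < sigma ^+ 2 by rewrite exprn_gt0.
  rewrite subr_gt0; nra.
- by rewrite gtrBl.
- have -> : (2^-1 - r) * (1 - (2^-1 - r)) = 4^-1 - r ^+ 2 by field.
  by rewrite rr; ring.
Qed.

Lemma decay_rate_le sigma : decay_rate sigma <= 2^-1.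
Proof. by rewrite /decay_rate gerBl sqrtr_ge0. Qed.

(* With [a = 1/(2 sigma)] the left side vanishes; with [a = 2 sigma] it is minus a sum of squares. *)
Lemma lyapunov_ineq sigma (m pa pb qa qb : R) : 0 < sigma -> 2 * sigma != 1 ->
  0 <= m <= 1 ->
  - 2 * (qa ^+ 2 + qb ^+ 2)
  - 2 * coupling sigma * sigma * (pa ^+ 2 + pb ^+ 2 - qa ^+ 2 - qb ^+ 2)
  + 2 * coupling sigma * m * (qb * pa - qa * pb)
  + 2 * decay_rate sigma * (pa ^+ 2 + pb ^+ 2 + qa ^+ 2 + qb ^+ 2
                            - 2 * coupling sigma * m * (qb * pa - qa * pb)) <= 0.
Proof.
move=> s0 s1 /andP[m0 m1]; set X := qb * pa - qa * pb; set lam := decay_rate sigma.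
rewrite /coupling; case: (ltrP 1 (2 * sigma)) => s2.
  have -> : lam = 2^-1 by exact: decay_rate_fast.
  rewrite le_eqVlt; apply/orP; left; apply/eqP; rewrite /X; field.
  by rewrite gt_eqF.
have {}s2 : 2 * sigma < 1 by rewrite lt_neqAle s1.
have [l0 l1 ll] := decay_rate_slow s0 s2; rewrite -/lam in l0 l1 ll.
(* With this [r], [sigma = r (1 - lam)] and [lam = r^2 (1 - lam)], which turns the quadratic
   relation for [lam] into an explicit sum of squares. Its coefficients are nonnegative because
   [lam < 1/2] and [m <= 1]. *)
set r := sigma / (1 - lam).
have L0 : 0 < 1 - lam by lra.
have sE : sigma = r * (1 - lam) by rewrite /r divfK// gt_eqF.
have lE : lam = r ^+ 2 * (1 - lam).
  have : (1 - lam) * lam = (1 - lam) * (r ^+ 2 * (1 - lam)).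
    by rewrite mulrC ll sE; ring.
  by move/(mulfI (lt0r_neq0 L0)).
rewrite -oppr_ge0.
have -> : - (- 2 * (qa ^+ 2 + qb ^+ 2)
  - 2 * (2 * sigma) * sigma * (pa ^+ 2 + pb ^+ 2 - qa ^+ 2 - qb ^+ 2) + 2 * (2 * sigma) * m * X
  + 2 * lam * (pa ^+ 2 + pb ^+ 2 + qa ^+ 2 + qb ^+ 2 - 2 * (2 * sigma) * m * X)) =
  (1 - 2 * lam) * (2 * (1 - lam) * ((qb - m * r * pa) ^+ 2 + (qa + m * r * pb) ^+ 2) +
     2 * (r ^+ 2 * (1 - lam)) * (1 - m ^+ 2) * (pa ^+ 2 + pb ^+ 2)).
  have -> : 2 * (2 * sigma) * sigma = 4 * (lam * (1 - lam)) by rewrite ll; ring.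
  rewrite -lE /X [in LHS]sE.
  have -> : (1 - 2 * lam) * (2 * (1 - lam) * ((qb - m * r * pa) ^+ 2 + (qa + m * r * pb) ^+ 2) +
     2 * lam * (1 - m ^+ 2) * (pa ^+ 2 + pb ^+ 2)) =
    (1 - 2 * lam) * (2 * (1 - lam) * (qb ^+ 2 + qa ^+ 2 - 2 * m * r * (qb * pa - qa * pb))
     + 2 * m ^+ 2 * (r ^+ 2 * (1 - lam)) * (pa ^+ 2 + pb ^+ 2) +
     2 * lam * (1 - m ^+ 2) * (pa ^+ 2 + pb ^+ 2)) by ring.
  by rewrite -lE; ring.
apply: mulr_ge0; first by lra.
apply: addr_ge0.
  by rewrite mulr_ge0 ?addr_ge0 ?sqr_ge0// mulr_ge0// ltW.
rewrite -lE mulr_ge0 ?addr_ge0 ?sqr_ge0// mulr_ge0 ?subr_ge0 ?exprn_ile1//.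
by rewrite mulr_ge0// ltW.
Qed.

Section ModeDecay.
Variables (sigma : R) (k : nat) (u v : bool -> R -> R).
Hypothesis uv : mode_system sigma k u v.

Let p b (t : R) := u b t + v b t.
Let q b (t : R) := u b t - v b t.

Let dp b (t : R) : 0 < t ->
  is_derive t 1 (p b) (sigma * ((if b then k%:R else - k%:R) * q (~~ b) t)).
Proof.
move=> t0; have [du dv _ _] := uv; have d1 := du b t t0; have d2 := dv b t t0.
by apply: is_derive_eq; rewrite /q; field.
Qed.

Let dq b (t : R) : 0 < t ->
  is_derive t 1 (q b) (sigma * ((if b then k%:R else - k%:R) * p (~~ b) t) - q b t).
Proof.
move=> t0; have [du dv _ _] := uv; have d1 := du b t t0; have d2 := dv b t t0.
by apply: is_derive_eq; rewrite /p /q; field.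
Qed.

Let cp b : p b t @[t --> 0^'+] --> p b 0.
Proof. by have [_ _ cu cv] := uv; apply: cvgD; [exact: cu|exact: cv]. Qed.

Let cq b : q b t @[t --> 0^'+] --> q b 0.
Proof. by have [_ _ cu cv] := uv; apply: cvgB; [exact: cu|exact: cv]. Qed.

Lemma mode_energyE t : mode_energy u v t =
  p false t ^+ 2 + p true t ^+ 2 + q false t ^+ 2 + q true t ^+ 2.
Proof. by rewrite /mode_energy big_bool/= /p /q; ring. Qed.

(** The functional [E] decays at rate [2 lam] and lies between [1 - a] and [1 + a] times the energy:
    the energy plus or minus twice the cross product is a sum of squares, and [m = 1 / k] is at most
    [1]. The ratio of these bounds is the constant. *)
Lemma mode_decay : 0 < sigma -> 2 * sigma != 1 -> (0 < k)%N ->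
  forall t : R, 0 <= t -> mode_energy u v t <=
    (1 + coupling sigma) / (1 - coupling sigma) *
    expR (- (2 * decay_rate sigma * t)) * mode_energy u v 0.
Proof.
move=> s0 s1 k0 t t0; set a := coupling sigma; set lam := decay_rate sigma.
have /andP[a0 a1] := coupling_lt1 s0 s1; rewrite -/a in a0 a1.
pose m : R := k%:R^-1.
have kR : (0 : R) < k%:R by rewrite ltr0n.
have m0 : 0 <= m by rewrite invr_ge0 ltW.
have m1 : m <= 1 by rewrite invf_le1// ler1n.
pose E (s : R) := p false s * p false s + p true s * p true s + q false s * q false s + q true s * q true s
  - (2 * a * m) * (q true s * p false s - q false s * p true s).
(* The rotation part of the system differentiates the cross term into [sigma * k] times a difference
   of squares, and [m] cancels this [k]; the damping of [q] leaves the last line. *)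
pose dE (s : R) := - 2 * (q false s ^+ 2 + q true s ^+ 2)
  - 2 * a * sigma * (p false s ^+ 2 + p true s ^+ 2 - q false s ^+ 2 - q true s ^+ 2)
  + 2 * a * m * (q true s * p false s - q false s * p true s).
have dEs (s : R) : 0 < s -> is_derive s 1 E (dE s).
  move=> sgt0; have -> : E = p false * p false + p true * p true + q false * q false + q true * q true
    - (2 * a * m) *: (q true * p false - q false * p true) by apply/funext.
  have := dp false sgt0; have := dp true sgt0; have := dq false sgt0; have := dq true sgt0.
  move=> /= d1 d2 d3 d4; apply: is_derive_eq.
  by rewrite /GRing.scale/= /dE /m; field; rewrite gt_eqF.
have EcE (s : R) : 0 < s -> dE s + (2 * lam) * E s <= 0.
  move=> _; have := @lyapunov_ineq sigma m (p false s) (p true s) (q false s) (q true s) s0 s1.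
  by rewrite m0 m1 => /(_ isT); rewrite /dE /E -/a -/lam -!expr2; apply: le_trans; lra.
have cE : E s @[s --> 0^'+] --> E 0.
  apply: cvgB; last first.
    by apply: cvgMr; apply: cvgB; apply: cvgM.
  by apply: cvgD; [apply: cvgD; [apply: cvgD|]|]; apply: cvgM.
have Et := derive_le_exp_decay dEs EcE cE t0.
have Elo (s : R) : (1 - a) * mode_energy u v s <= E s /\ E s <= (1 + a) * mode_energy u v s.
  rewrite mode_energyE /E.
  set X := q true s * p false s - q false s * p true s.
  set Q := p false s ^+ 2 + _ + _ + _.
  have XQ : `|2 * m * X| <= Q.
    have Q0 : `|2 * X| <= Q.
      rewrite ler_norml /X /Q; apply/andP; split; rewrite -subr_ge0.
      - have -> : 2 * (q true s * p false s - q false s * p true s) - - (p false s ^+ 2 +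
          p true s ^+ 2 + q false s ^+ 2 + q true s ^+ 2) = (q true s + p false s) ^+ 2 +
          (q false s - p true s) ^+ 2 by ring.
        by rewrite addr_ge0 ?sqr_ge0.
      - have -> : p false s ^+ 2 + p true s ^+ 2 + q false s ^+ 2 + q true s ^+ 2 -
          2 * (q true s * p false s - q false s * p true s) = (q true s - p false s) ^+ 2 +
          (q false s + p true s) ^+ 2 by ring.
        by rewrite addr_ge0 ?sqr_ge0.
    apply: le_trans Q0; rewrite mulrAC normrM (ger0_norm m0).
    by rewrite ler_piMr.
  move: XQ; rewrite ler_norml => /andP[X1 X2].
  have -> : p false s * p false s + p true s * p true s + q false s * q false s
    + q true s * q true s - 2 * a * m * X = Q - a * (2 * m * X) by rewrite /Q; ring.
  have := ler_wpM2l (ltW a0) X1; have := ler_wpM2l (ltW a0) X2.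
  by move=> *; split; lra.
have [lo _] := Elo t; have [_ hi] := Elo 0.
have a1' : 0 < 1 - a by rewrite subr_gt0.
rewrite -(ler_pM2l a1'); apply: (le_trans lo); apply: (le_trans Et).
have -> : (1 - a) * ((1 + a) / (1 - a) * expR (- (2 * lam * t)) * mode_energy u v 0) =
    expR (- (2 * lam * t)) * ((1 + a) * mode_energy u v 0) by field; rewrite gt_eqF.
by rewrite ler_wpM2l ?expR_ge0.
Qed.

(** At frequency [0] transport disappears: [p] is conserved and so stays [0], while [q' = - q] gives
    [q ^+ 2] the rate [2], which exceeds [2 lam] since [lam <= 1/2]. *)
Lemma mode0_decay : k = 0%N -> (forall b, u b 0 + v b 0 = 0) ->
  forall t : R, 0 <= t ->
    mode_energy u v t <= expR (- (2 * decay_rate sigma * t)) * mode_energy u v 0.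
Proof.
move=> k0 p0 t t0; rewrite /mode_energy mulr_sumr; apply: ler_sum => b _.
have pt : p b t * p b t <= 0.
  have d1 (s : R) : 0 < s -> is_derive s 1 (p b * p b) 0.
    move=> s0; have := dp b s0; rewrite k0 oppr0 if_same mul0r mulr0 => d.
    by apply: is_derive_eq; rewrite !scaler0 addr0.
  have : p b t * p b t <= expR (- (0 * t)) * (p b 0 * p b 0).
    apply: (@derive_le_exp_decay _ (p b * p b) (fun=> 0) 0 d1) => //.
      by move=> s _; rewrite mul0r addr0.
    by apply: cvgM; exact: cp.
  by rewrite {4}/p p0 !mulr0.
have qt : q b t * q b t <= expR (- (2 * decay_rate sigma * t)) * (q b 0 * q b 0).
  have d2 (s : R) : 0 < s -> is_derive s 1 (q b * q b) (- 2 * q b s ^+ 2).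
    move=> s0; have := dq b s0; rewrite k0 oppr0 if_same mul0r mulr0 sub0r => d.
    by apply: is_derive_eq; rewrite /GRing.scale/=; ring.
  apply: (@derive_le_exp_decay _ (q b * q b) _ (2 * decay_rate sigma) d2) => //.
    move=> s _; have := decay_rate_le sigma; have := sqr_ge0 (q b s).
    move=> q0 lam2; suff : - 2 * q b s ^+ 2 + 2 * decay_rate sigma * (q b s * q b s) <= 0 by [].
    by nra.
  by apply: cvgM; exact: cq.
rewrite p0 expr0n add0r -/(p b t) -/(q b t) -/(q b 0) !expr2.
by rewrite -[leRHS]add0r lerD.
Qed.

End ModeDecay.

End FourierMode.

(** * Summation over the modes *)

Section Parseval.
Context (R : realType).
Implicit Types (f g h : R -> R) (b : bool) (k N : nat).
Local Notation Rint := (@Defs.Rint R).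

(** The inequality of Parseval opposite to Bessel's, obtained from density with an arbitrarily small
    loss [eps]. *)
Lemma sqint_le_fsqsum g (B : R) : L2fun g -> (forall N, fsqsum N g <= B) -> sqint g <= B.
Proof.
move=> Lg gB; apply/ler_addgt0Pr => eps eps0.
have [_ /(_ _ eps0)[T tT gT]] := trig_approximable_L2fun Lg.
have [N gN] := sqint_trigpoly_approx Lg tT.
by apply: (le_trans gN); rewrite addrC lerD// ltW.
Qed.

Lemma fcoefD b k f g : L2fun f -> L2fun g ->
  fcoef b k (fun x => f x + g x) = fcoef b k f + fcoef b k g.
Proof.
move=> Lf Lg; rewrite /fcoef -RintD;
  [|exact: (L2funM Lf (L2fun_trig R b k))|exact: (L2funM Lg (L2fun_trig R b k))].
by apply: eq_Rint => x _; rewrite mulrDl.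
Qed.

Lemma fcoefZ b k (a : R) f : L2fun f -> fcoef b k (fun x => a * f x) = a * fcoef b k f.
Proof.
move=> Lf; rewrite /fcoef -RintZ; last exact: (L2funM Lf (L2fun_trig R b k)).
by apply: eq_Rint => x _; rewrite mulrA.
Qed.

Lemma fcoefB b k f g : L2fun f -> L2fun g ->
  fcoef b k (fun x => f x - g x) = fcoef b k f - fcoef b k g.
Proof.
move=> Lf Lg; have := fcoefD b k Lf (L2funZ (-1) Lg).
by rewrite fcoefZ// mulN1r => <-; congr fcoef; apply/funext => x; rewrite mulN1r.
Qed.

Lemma fcoef_cst b k (a : R) : fcoef b k (fun=> a) = a * Rint (trig b k).
Proof. by rewrite /fcoef RintZ//; exact: (L2fun_integrable (L2fun_trig R b k)). Qed.

Definition pair_mode k g h : R :=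
  \sum_(b : bool) ((fcoef b k g + fcoef b k h) ^+ 2 + (fcoef b k g - fcoef b k h) ^+ 2).

(** The cosine weight serves both components: the weights agree for [k > 0], and at [k = 0] the sine
    coefficients vanish. *)
Lemma fsqsum_pairE N g h : L2fun g -> L2fun h ->
  fsqsum N (fun x => g x + h x) + fsqsum N (fun x => g x - h x) =
  \sum_(k < N) (trig_weight R false k)^-1 * pair_mode k g h.
Proof.
move=> Lg Lh; rewrite /fsqsum -big_split/=; apply: eq_bigr => k _.
rewrite /pair_mode !big_bool/= !fcoefB// !fcoefD//.
have [->|k0] := eqVneq (k : nat) 0%N.
  by rewrite !fcoef_sin0; ring.
by rewrite /trig_weight (negbTE k0); ring.
Qed.

(** Bessel's inequality bounds the initial partial sums, the mode estimates carry the bound over,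
    and [sqint_le_fsqsum] returns to the norms. *)
Lemma pair_decay g h g0 h0 (B : R) : L2fun g -> L2fun h -> L2fun g0 -> L2fun h0 -> 0 <= B ->
  (forall k, pair_mode k g h <= B * pair_mode k g0 h0) ->
  sqint g + sqint h <= 2 * B * (sqint g0 + sqint h0).
Proof.
move=> Lg Lh Lg0 Lh0 B0 H.
have Lp := L2funD Lg Lh; have Lq := L2funB Lg Lh.
have Lp0 := L2funD Lg0 Lh0; have Lq0 := L2funB Lg0 Lh0.
pose C := B * (2 * (sqint g0 + sqint h0)).
have HN N : fsqsum N (fun x => g x + h x) + fsqsum N (fun x => g x - h x) <= C.
  apply: (@le_trans _ _ (B * (fsqsum N (fun x => g0 x + h0 x) + fsqsum N (fun x => g0 x - h0 x)))).
    rewrite !fsqsum_pairE// mulr_sumr; apply: ler_sum => k _.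
    by rewrite mulrCA ler_wpM2l ?invr_ge0 ?trig_weight_ge0.
  by rewrite /C -sqint_parallelogram// ler_wpM2l// lerD// fsqsum_le.
have fs0 N f : 0 <= fsqsum N f.
  apply: sumr_ge0 => k _; apply: sumr_ge0 => b _.
  by rewrite divr_ge0 ?sqr_ge0 ?trig_weight_ge0.
(* Sum and difference are each bounded by the full constant [C]; this is the origin of the factor
   [2] in the conclusion. *)
have pC : sqint (fun x => g x + h x) <= C.
  apply: sqint_le_fsqsum => // N; apply: le_trans (HN N).
  by rewrite lerDl.
have qC : sqint (fun x => g x - h x) <= C.
  apply: sqint_le_fsqsum => // N; apply: le_trans (HN N).
  by rewrite lerDr.
have := sqint_parallelogram Lg Lh; rewrite /C in pC qC *; lra.
Qed.

End Parseval.

(** * The Fourier modes of a weak solution *)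

Section WeakSolutionModes.
Context (R : realType).
Local Open Scope classical_set_scope.
Local Open Scope ring_scope.
Variables (sigma : R) (fIp fIm : R -> R) (fp fm : R -> R -> R).
Hypotheses (LIp : L2fun fIp) (LIm : L2fun fIm).
Hypothesis ws : weak_solution sigma fIp fIm fp fm.
Implicit Types (b : bool) (k : nat) (t : R).
Local Notation Rint := (@Defs.Rint R).

Let c := finf fIp fIm.
Let u k b t := fcoef b k (fp t) - c * Rint (trig b k).
Let v k b t := fcoef b k (fm t) - c * Rint (trig b k).

Let Lp t : 0 <= t -> L2fun (fp t).
Proof. by have [L _ _ _ _] := ws; move=> /L[]. Qed.

Let Lm t : 0 <= t -> L2fun (fm t).
Proof. by have [L _ _ _ _] := ws; move=> /L[]. Qed.

Let uE k b t : 0 <= t -> fcoef b k (fun x => fp t x - c) = u k b t.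
Proof. by move=> /Lp Lt; rewrite fcoefB ?fcoef_cst//; exact: L2fun_cst. Qed.

Let vE k b t : 0 <= t -> fcoef b k (fun x => fm t x - c) = v k b t.
Proof. by move=> /Lm Lt; rewrite fcoefB ?fcoef_cst//; exact: L2fun_cst. Qed.

(** Either the frequency or the mean of the trigonometric function is [0], so subtracting the
    constant state leaves the transport term unchanged. *)
Let frequency_mean b k : (if b then k%:R else - k%:R) * Rint (trig (~~ b) k) = 0 :> R.
Proof.
have [->|k0] := eqVneq k 0%N; first by rewrite oppr0 if_same mul0r.
by rewrite Rint_trig// mulr0.
Qed.

Let Rint_dtrig b k f : L2fun f ->
  Rint (fun x => f x * derive1 (trig b k) x) =
  (if b then k%:R else - k%:R) * (fcoef (~~ b) k f - c * Rint (trig (~~ b) k)).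
Proof.
move=> Lf; rewrite mulrBr mulrCA frequency_mean mulr0 subr0 /fcoef -RintZ.
  by apply: eq_Rint => x _; rewrite derive1_trig dtrigE mulrCA.
exact: (L2funM Lf (L2fun_trig R _ _)).
Qed.

Let coef_cvg0 (w : R -> R -> R) b k : (forall t, 0 <= t -> L2fun (w t)) ->
  (forall e : R, 0 < e -> exists2 d, 0 < d & forall t, 0 <= t -> `|t| < d ->
     sqint (fun x => w t x - w 0 x) < e ^+ 2) ->
  fcoef b k (w t) - c * Rint (trig b k) @[t --> 0^'+] -->
  fcoef b k (w 0) - c * Rint (trig b k).
Proof.
move=> Lw cw; apply: cvgB; last exact: cvg_cst.
apply/cvgrPdist_lt => eps eps0; have p0 := twopi_gt0 R.
(* Chosen because [fcoef_sqr_le] costs a factor [2 * pi], which is less than [(2 * pi + 1) ^+ 2]. *)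
have e0 : 0 < eps / (2 * pi + 1) by rewrite divr_gt0//; lra.
have [d d0 H] := cw _ e0; near=> t.
have t0 : 0 < t by near: t; exact: nbhs_right_gt.
have td : t < d by near: t; exact: nbhs_right_lt.
have {}H : sqint (fun x => w t x - w 0 x) < (eps / (2 * pi + 1)) ^+ 2.
  by apply: H; [exact: ltW|rewrite gtr0_norm].
have L0 := Lw 0 (lexx 0); have Lt := Lw t (ltW t0).
rewrite distrC -fcoefB//; set z : R := fcoef b k _.
suff z2 : z ^+ 2 < eps ^+ 2.
  by have : `|z| < eps; first by rewrite ltr_norml; apply/andP; split; nra.
apply: le_lt_trans (fcoef_sqr_le b k (L2funB Lt L0)) _.
apply: (@lt_trans _ _ (2 * pi * (eps / (2 * pi + 1)) ^+ 2)); first by rewrite ltr_pM2l.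
have -> : eps ^+ 2 = (2 * pi + 1) ^+ 2 * (eps / (2 * pi + 1)) ^+ 2.
  by rewrite -exprMn mulrCA divff ?mulr1//; lra.
rewrite ltr_pM2r ?exprn_gt0//; nra.
Unshelve. all: by end_near. Qed.

Lemma weak_solution_mode_system k : mode_system sigma k (u k) (v k).
Proof.
have [L ct init dfp dfm] := ws.
have ct0 (e : R) : 0 < e -> exists2 d, 0 < d & forall t, 0 <= t -> `|t| < d ->
    sqint (fun x => fp t x - fp 0 x) < e ^+ 2 /\ sqint (fun x => fm t x - fm 0 x) < e ^+ 2.
  move=> e0; have [d d0 H] := ct 0 (lexx 0) e e0; exists d => // t t0 td.
  have := H t t0; rewrite subr0 => /(_ td).
  rewrite L2norm2E; [|by apply: L2funB; auto..].
  have s1 := sqint_ge0 (fun x => fp t x - fp 0 x); have s2 := sqint_ge0 (fun x => fm t x - fm 0 x).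
  rewrite -ltr_sqr ?nnegrE ?sqrtr_ge0 ?ltW// sqr_sqrtr ?addr_ge0// => H2.
  by split; lra.
split.
- move=> b t t0; have t0' := ltW t0; have d := dfp _ (test_fun_trig R b k) t t0.
  have {}d := is_deriveB d (is_derive_cst (c * Rint (trig b k)) t 1).
  apply: (is_derive_eq d); rewrite subr0 Rint_dtrig; last exact: Lp.
  congr (_ + _ * _).
  rewrite -/(fcoef b k (fun x => fm t x - fp t x)) fcoefB; [|exact: Lm|exact: Lp].
  by rewrite /u /v; ring.
- move=> b t t0; have t0' := ltW t0; have d := dfm _ (test_fun_trig R b k) t t0.
  have {}d := is_deriveB d (is_derive_cst (c * Rint (trig b k)) t 1).
  apply: (is_derive_eq d); rewrite subr0 Rint_dtrig; last exact: Lm.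
  congr (_ + _ * _).
  rewrite -/(fcoef b k (fun x => fp t x - fm t x)) fcoefB; [|exact: Lp|exact: Lm].
  by rewrite /u /v; ring.
- move=> b; apply: coef_cvg0 => // e e0; have [d d0 H] := ct0 _ e0.
  by exists d => // t t0 td; have [] := H t t0 td.
- move=> b; apply: coef_cvg0 => // e e0; have [d d0 H] := ct0 _ e0.
  by exists d => // t t0 td; have [] := H t t0 td.
Qed.

(** The initial datum is attained only in the [L^2] sense; by [fcoef_sqr_le] that suffices for equal
    coefficients. *)
Let fcoef_initial b k :
  fcoef b k (fp 0) = fcoef b k fIp /\ fcoef b k (fm 0) = fcoef b k fIm.
Proof.
have [_ _ + _ _] := ws; have Lp0 := Lp (lexx 0); have Lm0 := Lm (lexx 0).
rewrite L2norm2E; [|exact: L2funB..] => /eqP.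
have sp := sqint_ge0 (fun x => fp 0 x - fIp x); have sm := sqint_ge0 (fun x => fm 0 x - fIm x).
rewrite sqrtr_eq0 => s0.
have coef0 f g : L2fun f -> L2fun g -> sqint (fun x => f x - g x) <= 0 -> fcoef b k f = fcoef b k g.
  move=> Lf Lg fg; apply/eqP; rewrite -subr_eq0 -sqrf_eq0 eq_le sqr_ge0 andbT -fcoefB//.
  apply: le_trans (fcoef_sqr_le b k (L2funB Lf Lg)) _.
  by rewrite mulr_ge0_le0// ltW// twopi_gt0.
by split; apply: coef0 => //; lra.
Qed.

(** The normalization [(4 * pi)^-1] in [finf] gives the constant state the total mass of the initial
    datum; the sine part is trivial. *)
Let mean_zero b : u 0 b 0 + v 0 b 0 = 0.
Proof.
have [pI mI] := fcoef_initial b 0; rewrite /u /v pI mI => {pI mI}.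
case: b.
  have s0 : Rint (trig true 0) = 0.
    rewrite (eq_Rint (g := fun=> 0)) ?Rint_cst ?mul0r// => x _.
    by rewrite /trig mul0r sin0.
  by rewrite !fcoef_sin0 s0; ring.
have trig1 x : @trig R false 0 x = 1 by rewrite /trig mul0r cos0.
have coef1 f : fcoef false 0 f = Rint f.
  by apply: eq_Rint => x _; rewrite trig1 mulr1.
have -> : Rint (trig false 0) = 2 * pi.
  by rewrite (eq_Rint (g := fun=> 1)) ?Rint_cst ?mul1r.
rewrite !coef1 /c /finf RintD; [|exact: L2fun_integrable..].
have pi0 : pi != 0 :> R by rewrite gt_eqF// pi_gt0.
by move: (pi : R) pi0 => P P0; field.
Qed.

Lemma weak_solution_pair_mode_decay k t : 0 < sigma -> 2 * sigma != 1 -> 0 <= t ->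
  pair_mode k (fun x => fp t x - c) (fun x => fm t x - c) <=
  (1 + coupling sigma) / (1 - coupling sigma) * expR (- (2 * decay_rate sigma * t)) *
  pair_mode k (fun x => fIp x - c) (fun x => fIm x - c).
Proof.
move=> s0 s1 t0.
have LpI := L2funB LIp (L2fun_cst c); have LmI := L2funB LIm (L2fun_cst c).
have modeE s : 0 <= s -> pair_mode k (fun x => fp s x - c) (fun x => fm s x - c) =
    mode_energy (u k) (v k) s.
  by move=> s0'; apply: eq_bigr => b _; rewrite uE// vE.
have -> : pair_mode k (fun x => fIp x - c) (fun x => fIm x - c) = mode_energy (u k) (v k) 0.
  apply: eq_bigr => b _; rewrite !fcoefB ?fcoef_cst//; try exact: L2fun_cst.
  by have [<- <-] := fcoef_initial b k.
rewrite modeE//; have [k0|k0] := posnP k; last exact: (mode_decay (weak_solution_mode_system k)).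
have := mode0_decay (weak_solution_mode_system k) k0.
rewrite k0 => /(_ mean_zero t t0) H; apply: (le_trans H).
have /andP[a0 a1] := coupling_lt1 s0 s1.
have M0 : 0 <= mode_energy (u 0) (v 0) 0.
  by apply: sumr_ge0 => b _; rewrite addr_ge0 ?sqr_ge0.
(* As [(1 + a) / (1 - a)] is at least [1], the bound for frequency [0] fits the common form. *)
rewrite ler_wpM2r// ler_peMl ?expR_ge0// ler_pdivlMr ?subr_gt0// mul1r.
lra.
Qed.

End WeakSolutionModes.

(** * Decay of weak solutions towards the constant state *)

Theorem theorem6 (R : realType) (sigma : R) (hsigma : 0 < sigma)
  (hnat : forall n : nat, (2 * sigma)^-1 != n%:R) :
  exists c : R, 0 < c /\
    forall (fIp fIm : R -> R) (fp fm : R -> R -> R),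
      L2fun fIp -> L2fun fIm ->
      weak_solution sigma fIp fIm fp fm ->
      forall t : R, 0 <= t ->
        L2norm2 (fun x => fp t x - finf fIp fIm) (fun x => fm t x - finf fIp fIm)
        <= c * expR (- (decay_rate sigma * t)) *
           L2norm2 (fun x => fIp x - finf fIp fIm) (fun x => fIm x - finf fIp fIm).
Proof.
(* The instance [n = 1] excludes the value of [sigma] at which the mode [k = 1] has a double
   eigenvalue. *)
have s1 : 2 * sigma != 1 by have := hnat 1%N; rewrite invr_eq1.
have /andP[a0 a1] := coupling_lt1 hsigma s1.
pose C := (1 + coupling sigma) / (1 - coupling sigma).
have C0 : 0 < C by apply: divr_gt0; lra.
(* [C] bounds the energy of each mode, [2] comes from [pair_decay], and the root passes from squared
   norms to norms. *)
exists (Num.sqrt (2 * C)); split; first by rewrite sqrtr_gt0 mulr_gt0.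
move=> fIp fIm fp fm LIp LIm ws t t0; have [L _ _ _ _] := ws; have [Lp Lm] := L t t0.
set c := finf fIp fIm; have Lc := L2fun_cst c.
rewrite !L2norm2E; [|exact: L2funB..].
set e := expR _.
have e0 : 0 <= e by exact: expR_ge0.
have -> : e = Num.sqrt (e ^+ 2) by rewrite sqrtr_sqr ger0_norm.
have C2 : 0 <= 2 * C by rewrite mulr_ge0// ltW.
rewrite -(sqrtrM _ C2) -sqrtrM; last by rewrite mulr_ge0// sqr_ge0.
apply: ler_wsqrtr.
have -> : e ^+ 2 = expR (- (2 * decay_rate sigma * t)).
  by rewrite -expRM_natl; congr expR; ring.
rewrite -[2 * C * _]mulrA.
apply: pair_decay; try exact: L2funB.
  by rewrite mulr_ge0 ?expR_ge0 ?ltW.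
by move=> k; exact: weak_solution_pair_mode_decay.
Qed.
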